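(* Let $\Gamma$ be a chain of $g$ cycles with torsion profile $\underline{m}=(m_2,\dots,m_g)$, with marked point $w=w_g$ on the rightmost cycle. Then $(\Gamma,w)$ is Brill-Noether general (as a marked metric graph) if and only if for each $i\in\{2,3,\dots,g\}$, either $m_i=0$ or $m_i>i$.
   Context: A chain of $g$ cycles is a metric graph $\Gamma$ of genus $g$ formed from $g$ cycles (circles), the $i$th of length $\ell_i>0$ with two distinct points $v_i\neq w_i$ on it, where for $1\le i<g$ the point $w_i$ is joined to $v_{i+1}$ by a bridge (an edge of arbitrary length $\geq 0$; length $0$ means $w_i$ and $v_{i+1}$ are identified). Edge lengths are arbitrary. The marked point is $w_g$, on the last (rightmost) cycle. Fix a clockwise orientation on each cycle and let $\ell(v_iw_i)$ be the length of the clockwise edge from $v_i$ to $w_i$. The $i$th torsion order $m_i$ is $0$ if $\ell(v_iw_i)$ is an irrational multiple of $\ell_i$; otherwise $m_i$ is the minimum positive integer such that $m_i\cdot\ell(v_iw_i)$ is an integer multiple of $\ell_i$. The torsion profile is $\underline{m}=(m_2,\dots,m_g)$. A partition is a finite non-increasing sequence $\lambda=(\lambda_0,\dots,\lambda_r)$ of nonnegative integers (up to trailing zeros), identified with the subset $\{(x,y)\in\mathbf{Z}_{>0}^2: 1\le x\le\lambda_{y-1},\ 1\le y\le r+1\}$; $|\lambda|$ is the number of elements of this set. For a metric graph $\Gamma$ of genus $g$, $w\in\Gamma$ and a partition $\lambda$, $W^\lambda(\Gamma,w)=\{[D]\in\mathrm{Pic}^0(\Gamma): r(D+d'\cdot w)\ge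 r' \text{ whenever } (g-d'+r',\,r'+1)\in\lambda\}$, where $r(\cdot)$ is the Baker-Norine rank and $d',r'$ range over the integers. The marked metric graph $(\Gamma,w)$ is Brill-Noether general if for all partitions $\lambda$, $\dim W^\lambda(\Gamma,w)=g-|\lambda|$ if this number is nonnegative, and $W^\lambda(\Gamma,w)$ is empty otherwise. *)

(* Defs.v *)
From HB Require Import structures.
From mathcomp Require Import all_boot all_order all_algebra.
From mathcomp Require Import boolp classical_sets reals.
From mathcomp.multinomials Require Import freeg.

Set Implicit Arguments.
Unset Strict Implicit.
Unset Printing Implicit Defensive.

Import Order.TTheory GRing.Theory Num.Theory.
Local Open Scope ring_scope.
Local Open Scope classical_set_scope.

(* freeg shadows this name. *)
Local Notation lift := fintype.lift.

Definition adjacent (V E : finType) (src tgt : E -> V) : rel V :=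
  fun x y => [exists e, ((src e == x) && (tgt e == y))
                     || ((src e == y) && (tgt e == x))].

(* A metric graph is presented by a finite connected multigraph with positive
   edge lengths; the orientation of the edges is auxiliary. *)
Record metric_graph (R : realType) := MetricGraph {
  vtx : finType;
  edg : finType;
  src : edg -> vtx;
  tgt : edg -> vtx;
  len : edg -> R;
  len_gt0 : forall e, 0 < len e;
  mg_connected : forall x y, connect (adjacent src tgt) x y }.

Arguments src {R m} _.
Arguments tgt {R m} _.
Arguments len {R m} _.

Section MetricGraph.
Context {R : realType} (G : metric_graph R).

(* First Betti number of the (connected) graph. *)
Definition genus : nat := (#|edg G|.+1 - #|vtx G|)%N.

(* Either a vertex, or the point at distance t from the source of an edge e,
   strictly inside e. *)
Definition point : choiceType :=
  (vtx G + {x : edg G * R | 0 < x.2 < len x.1})%type.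

(* Clamped to the endpoints of e outside [0, len e]. *)
Definition edge_point (e : edg G) (t : R) : point :=
  match insub (e, t) with
  | Some x => inr x
  | None => inl (if t <= 0 then src e else tgt e)
  end.

Definition divisor := {freeg point / int}.

Definition effective (D : divisor) : Prop := forall p, 0 <= coeff p D.

(* Continuity on [0, L] is implied: pieces are closed intervals. *)
Definition integral_pl (L : R) (h : R -> R) : Prop :=
  exists breaks : seq R, forall x y : R, 0 <= x -> x <= y -> y <= L ->
    (forall z, z \in breaks -> ~~ (x < z < y)) ->
    exists m : int, forall t, x <= t <= y -> h t = h x + m%:~R * (t - x).

Definition rational_function (f : point -> R) : Prop :=
  forall e : edg G, integral_pl (len e) (fun t => f (edge_point e t)).

(* The slope of h at 0 in the positive direction. *)
Definition germ_slope (h : R -> R) : int :=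
  xget 0 [set m : int | exists2 eps : R, 0 < eps &
    forall t, 0 <= t < eps -> h t = h 0 + m%:~R * t].

(* The sum of the outgoing slopes of f at p; a loop at a vertex contributes
   two tangent directions. *)
Definition ord (f : point -> R) (p : point) : int :=
  match p with
  | inl v =>
      \sum_(e | src e == v) germ_slope (fun u => f (edge_point e u)) +
      \sum_(e | tgt e == v) germ_slope (fun u => f (edge_point e (len e - u)))
  | inr x =>
      let: (e, t) := val x in
      germ_slope (fun u => f (edge_point e (t + u))) +
      germ_slope (fun u => f (edge_point e (t - u)))
  end.

Definition lin_equiv (D D' : divisor) : Prop :=
  exists2 f : point -> R, rational_function f &
    forall p, coeff p (D - D') = ord f p.

Definition divisor_class (D : divisor) : set divisor :=
  [set D' | lin_equiv D D'].

Definition rank_ge (D : divisor) (r : int) : Prop :=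
  forall E : divisor, effective E -> deg E = r ->
    exists2 E' : divisor, effective E' & lin_equiv (D - E) E'.

(* Baker-Norine rank: the largest r with rank_ge D r. Since rank_ge D r is
   vacuous for r < 0, this is -1 when D has no effective representative. *)
Definition rank (D : divisor) : int :=
  xget (-1) [set r : int | rank_ge D r /\
                           forall r', rank_ge D r' -> r' <= r].

(* Pic^0, the group of classes of divisors of degree 0, is the real torus
   Omega^* / H_1(G, Z), where Omega, the space of harmonic 1-forms, is the space of circulations in R^E.  Moving a chip by s
   along the edge e moves the class along the functional omega |-> s omega_e,
   so that Omega^* is the quotient of the space R^E of displacements by the
   exact vectors, which are those orthogonal to all circulations. *)
Definition exact (a : edg G -> R) : Prop :=
  exists h : vtx G -> R, forall e, a e = h (tgt e) - h (src e).

(* S contains a k-dimensional cell: the image of a simplex with vertices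
   a_0, ..., a_k in prod_e [0, len e], affinely independent modulo exact
   vectors, under the map x |-> [D + sum_e (point of e at distance x_e)], which
   is affine into the torus.  Any nondegenerate k-simplex of the universal cover
   of the torus becomes of this form after shrinking. *)
Definition contains_cell (S : set (set divisor)) (k : nat) : Prop :=
  exists (D : divisor) (a : 'I_k.+1 -> edg G -> R),
    [/\ forall j e, 0 <= a j e <= len e,
        forall c : 'I_k -> R,
          exact (fun e => \sum_j c j * (a (lift ord0 j) e - a ord0 e)) ->
          forall j, c j = 0
      & forall t : 'I_k.+1 -> R, (forall j, 0 <= t j) -> \sum_j t j = 1 ->
          S (divisor_class
               (D + \sum_e << edge_point e (\sum_j t j * a j e) >>))].

(* Dimension of a polyhedral subset S of the torus Pic^0; the empty set has
   no dimension. *)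
Definition has_dim (S : set (set divisor)) (k : nat) : Prop :=
  contains_cell S k /\ forall k', contains_cell S k' -> (k' <= k)%N.

End MetricGraph.

Definition is_partition (lam : seq nat) : bool := sorted geq lam.

(* The pairs (x, y) with 1 <= x <= lam_(y-1) and 1 <= y <= size lam. *)
Definition boxes (lam : seq nat) : seq (int * int) :=
  [seq (x%:Z, y.+1%:Z) | y <- iota 0 (size lam), x <- iota 1 (nth 0%N lam y)].

Definition W {R : realType} (G : metric_graph R) (w : point G)
    (lam : seq nat) : set (set (divisor G)) :=
  [set divisor_class D | D in [set D : divisor G | deg D = 0 /\
    forall d r : int, ((genus G)%:Z - d + r, r + 1) \in boxes lam ->
      r <= rank (D + << d *g w >>)]].

Definition Brill_Noether_general {R : realType} (G : metric_graph R)
    (w : point G) : Prop :=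
  forall lam : seq nat, is_partition lam ->
    ((size (boxes lam) <= genus G)%N ->
       has_dim (W w lam) (genus G - size (boxes lam))) /\
    ((genus G < size (boxes lam))%N -> W w lam = set0).

(* A chain of n.+1 cycles, numbered from 0: the clockwise edge from v_i to w_i
   has length arc i, and bridge j joins w_j to v_(j+1). *)
Record chain_of_cycles (R : realType) (n : nat) := ChainOfCycles {
  cycle_len : 'I_n.+1 -> R;
  arc : 'I_n.+1 -> R;
  bridge : 'I_n -> R;
  arc_itv : forall i, 0 < arc i < cycle_len i;
  bridge_ge0 : forall j, 0 <= bridge j }.

Section Chain.
Context {R : realType} {n : nat} (C : chain_of_cycles R n).

Definition true_bridge : finType := {j : 'I_n | 0 < bridge C j}.

(* inl i is w_i, inr None is v_0 and inr (Some j) is v_(j+1) when bridge j has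
   positive length; when it has length 0, v_(j+1) is the vertex w_j. *)
Definition chain_vtx : finType := ('I_n.+1 + option true_bridge)%type.

Definition chain_w (i : 'I_n.+1) : chain_vtx := inl i.

Definition chain_v (i : 'I_n.+1) : chain_vtx :=
  match unlift ord0 i with
  | None => inr None
  | Some j => if insub j is Some b then inr (Some b)
              else chain_w (widen_ord (leqnSn n) j)
  end.

(* inl (i, true) is the clockwise edge from v_i to w_i, and inl (i, false) the
   clockwise edge from w_i to v_i. *)
Definition chain_edg : finType := ('I_n.+1 * bool + true_bridge)%type.

Definition chain_src (e : chain_edg) : chain_vtx :=
  match e with
  | inl (i, b) => if b then chain_v i else chain_w i
  | inr j => chain_w (widen_ord (leqnSn n) (val j))
  end.

Definition chain_tgt (e : chain_edg) : chain_vtx :=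
  match e with
  | inl (i, b) => if b then chain_w i else chain_v i
  | inr j => chain_v (lift ord0 (val j))
  end.

Definition chain_len (e : chain_edg) : R :=
  match e with
  | inl (i, b) => if b then arc C i else cycle_len C i - arc C i
  | inr j => bridge C (val j)
  end.

Lemma chain_len_gt0 e : 0 < chain_len e.
Proof.
case: e => [[i b]|j] /=; last exact: (valP j).
by have /andP[? ?] := arc_itv C i; case: b; rewrite ?subr_gt0.
Qed.

Lemma chain_connected x y : connect (adjacent chain_src chain_tgt) x y.
Proof.
set A := adjacent _ _.
have symA : connect_sym A.
  by apply: sym_connect_sym => a b; apply/existsP/existsP => -[e];
    rewrite orbC => He; exists e.
have edgeA e : connect A (chain_src e) (chain_tgt e).
  by apply/connect1/existsP; exists e; rewrite !eqxx.
have vw i : connect A (chain_v i) (chain_w i) := edgeA (inl (i, true)).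
have w0 (k : nat) (lt_kn : (k < n.+1)%N) :
    connect A (chain_w ord0) (chain_w (Ordinal lt_kn)).
  elim: k lt_kn => [|k IHk] lt_kn.
    by rewrite (_ : Ordinal _ = ord0) //; apply: val_inj.
  have ltk : (k < n)%N by [].
  have -> : Ordinal lt_kn = lift ord0 (Ordinal ltk) by apply: val_inj.
  apply: connect_trans (IHk (ltnW lt_kn)) _.
  apply: connect_trans (vw _).
  have -> : Ordinal (ltnW lt_kn) = widen_ord (leqnSn n) (Ordinal ltk).
    exact: val_inj.
  have [Hb|Hb] := boolP (0 < bridge C (Ordinal ltk)).
    exact: (edgeA (inr (Sub (Ordinal ltk) Hb))).
  by rewrite /chain_v liftK insubN.
have v0 i : connect A (chain_w ord0) (chain_v i).
  have := w0 i (ltn_ord i); rewrite (_ : Ordinal _ = i); last exact: val_inj.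
  by move/connect_trans; apply; rewrite symA.
have all0 z : connect A (chain_w ord0) z.
  case: z => [[k lt_kn]|[j|]]; first exact: w0.
    by have := v0 (lift ord0 (val j)); rewrite /chain_v liftK valK.
  by have := v0 ord0; rewrite /chain_v unlift_none.
by apply: connect_trans (all0 y); rewrite symA.
Qed.

Definition chain_graph : metric_graph R :=
  MetricGraph chain_len_gt0 chain_connected.

Lemma genus_chain : genus chain_graph = n.+1.
Proof.
rewrite /genus /= /chain_edg /chain_vtx.
rewrite !card_sum card_prod card_bool card_option !card_ord.
by rewrite muln2 -addnn -addnA -!addnS addnK.
Qed.

(* The point w_g on the last cycle. *)
Definition chain_mark : point chain_graph := inl (chain_w ord_max).

End Chain.

Lemma rational_multiple_torsion (R : realType) (a l : R) :
  (exists q : rat, a = ratr q * l) ->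
  exists m : nat, (0 < m)%N && `[< exists k : int, m%:R * a = k%:~R * l >].
Proof.
case=> q ->; exists `|denq q|%N; rewrite absz_gt0 denq_neq0 /=.
apply/asboolP; exists (numq q); rewrite mulrA; congr (_ * _).
rewrite pmulrn absz_denq.
rewrite -{2}[q]divq_num_den rmorphM fmorphV /= !ratr_int mulrC.
by rewrite -mulrA mulVf ?mulr1 // intr_eq0 denq_neq0.
Qed.

(* 0 when a is not a rational multiple of l, otherwise the least m > 0 such
   that m * a is an integer multiple of l. *)
Definition torsion_order (R : realType) (a l : R) : nat :=
  if pselect (exists q : rat, a = ratr q * l) is left rat_al
  then ex_minn (rational_multiple_torsion rat_al) else 0%N.

Definition torsion {R : realType} {n : nat} (C : chain_of_cycles R n)
    (i : 'I_n.+1) : nat :=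
  torsion_order (arc C i) (cycle_len C i).

(* Main.v *)
From HB Require Import structures.
From mathcomp Require Import all_boot all_order all_algebra.
From mathcomp Require Import boolp classical_sets reals.
From mathcomp.multinomials Require Import freeg.
From mathcomp Require Import zify ring lra.
Require Import Defs.

(** Coordinates.  Measure positions on the k-th cycle, of length l_k, clockwise
    from w_k, so that v_k sits at - a_k where a_k is the length of the clockwise
    edge from v_k to w_k.  Seen from this cycle, everything on its left sits at
    v_k and everything on its right at w_k.  By linearity a divisor acquires one
    coordinate in R / l_k Z for each cycle.  Abel's theorem for the chain
    ([lin_equivP]) says that two divisors are linearly equivalent exactly when
    they have the same degree and the same coordinates.  One direction is an
    integration by parts ([lin_equiv_linext]); for the other, the slopes of the
    required function are forced by conservation of flow up to one integer for
    each cycle, and equality of coordinates is what makes the function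
    single-valued ([potential_lin_equiv]).

    Effective classes.  Let a class have coordinates x_j, with j counted from 0.
    Read the chain from left to right and let s be the number of chips used so
    far.  Seen from cycle j they have coordinate - s a_j.  If x_j + s a_j is a
    multiple of l_j, no chip is needed on cycle j (the cycle lingers);
    otherwise one chip suffices.  The final value of s is the smallest degree of
    an effective divisor with these coordinates ([effective_equivP]).

    Rank.  To test the rank one subtracts an effective divisor E of degree r,
    chosen so as to destroy as many lingering cycles as possible.  The outcome is
    recorded by a partition that grows along the chain: cycle j adds a box to
    row r, of present length L, when the result is still a partition and
    x_j + (r + j - L) a_j is a multiple of l_j.  If mu is the final partition and
    g the number of cycles, a divisor of degree d has rank at least r if and only
    if r + g - mu_r <= d ([rank_ge_nat]).  Hence W^lam is the set of classes
    whose partition contains lam ([W_class]).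

    The theorem.  Two boxes can be added on the same cycle j only if the distance
    between their diagonals is a multiple of the torsion order.  Two corners of
    a partition with at most j boxes are at distance at most j + 1.  If each
    torsion order is 0 or large, every cycle therefore adds at most one box, and
    only when its coordinate takes one of finitely many values ([sum_rows_le]):
    a cell contained in W^lam has at least |lam| constant coordinates
    ([cell_le]).  Conversely lam can be filled one box at a time on the first
    |lam| cycles, which leaves the other coordinates free ([fill_partition],
    [free_cell]), so that the dimension is g - |lam|.  If on the other hand
    1 < m <= j + 1 for the torsion order m of cycle j, then the m - 1 cycles
    before it can be used to fill a column of height m - 1.  Its two corners are
    at distance m, so that cycle j adds both: m conditions produce a partition
    with m + 1 boxes ([fill_hook]), and W^lam is too large for this lam. *)

Set Implicit Arguments.
Unset Strict Implicit.
Unset Printing Implicit Defensive.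

Import Order.TTheory GRing.Theory Num.Theory.
Local Open Scope ring_scope.

(* The name is also that of a function on free groups. *)
Local Notation lift := fintype.lift.

(** * Additive functions of divisors *)

Section Evaluation.
Context {T : choiceType} {M : zmodType} (phi : T -> M).
Implicit Types D : {freeg T / int}.

(** The additive extension of a function on points to divisors: degrees,
    partial degrees and coordinates are all of this form. *)
Definition linext D : M := \sum_(p <- dom D) phi p *~ coeff p D.

(** Any list containing the support may be summed over, so that several
    divisors can be compared on a common list. *)
Lemma linext_seq D (s : seq T) : uniq s -> {subset dom D <= s} ->
  linext D = \sum_(p <- s) phi p *~ coeff p D.
Proof.
move=> Us sDs; rewrite (bigID (mem (dom D))) /= [X in _ + X]big1 ?addr0.
  rewrite -[RHS]big_filter /linext; apply: perm_big; apply: uniq_perm.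
  - exact: uniq_dom.
  - exact: filter_uniq.
  - move=> p; rewrite mem_filter /=; case: (boolP (p \in dom D)) => //= /sDs.
    by move->.
by move=> p /coeff_outdom ->; rewrite mulr0z.
Qed.

Lemma linext_is_additive : zmod_morphism linext.
Proof.
move=> D1 D2; pose s := undup (dom D1 ++ dom D2).
have Us : uniq s by apply: undup_uniq.
have s12 : {subset dom (D1 - D2) <= s} by move=> p /domB; rewrite mem_undup.
have s1 : {subset dom D1 <= s} by move=> p p1; rewrite mem_undup mem_cat p1.
have s2 : {subset dom D2 <= s}.
  by move=> p p2; rewrite mem_undup mem_cat p2 orbT.
rewrite (linext_seq Us s12) (linext_seq Us s1) (linext_seq Us s2).
by rewrite -sumrB; apply: eq_bigr => p _; rewrite coeffB mulrzBr.
Qed.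

HB.instance Definition _ := GRing.isZmodMorphism.Build _ _ linext linext_is_additive.

Lemma linextU k p : linext << k *g p >> = phi p *~ k.
Proof.
rewrite (@linext_seq _ [:: p]) //.
  by rewrite big_seq1 coeffU eqxx mulr1.
move=> q; rewrite mem_dom coeffU mem_seq1 [q == p]eq_sym.
by case: (p == q); rewrite //= mulr0 eqxx.
Qed.

End Evaluation.

Lemma deg_linext (T : choiceType) (D : {freeg T / int}) : deg D = linext (fun=> 1) D.
Proof.
rewrite -{1}(freeg_sumE D) raddf_sum /=; apply: eq_bigr => p _.
by rewrite degU intz.
Qed.

Lemma linext_split (T : choiceType) (M : zmodType) (phi : T -> M) (I : finType)
    (key : T -> I) (D : {freeg T / int}) :
  linext phi D = \sum_i \sum_(p <- dom D | key p == i) phi p *~ coeff p D.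
Proof. by rewrite /linext (partition_big key predT). Qed.

(** * Congruences *)

(** Membership in the subgroup l Z.  As 0 Z = 0, statements about degrees
    are the case l = 0 of statements about coordinates. *)
Definition multiple {R : realType} (l u : R) : Prop := exists z : int, u = z%:~R * l.

Section Congruence.
Context {R : realType} (l : R).
Implicit Types u v : R.

Lemma multiple0 : multiple l 0. Proof. by exists 0; rewrite mul0r. Qed.

Lemma multipleD u v : multiple l u -> multiple l v -> multiple l (u + v).
Proof. by move=> [a ->] [b ->]; exists (a + b); rewrite -mulrDl rmorphD. Qed.

Lemma multipleN u : multiple l u -> multiple l (- u).
Proof. by move=> [a ->]; exists (- a); rewrite rmorphN mulNr. Qed.

Lemma multipleB u v : multiple l u -> multiple l v -> multiple l (u - v).
Proof. by move=> ? ?; apply: multipleD => //; apply: multipleN. Qed.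

Lemma multipleMz u (z : int) : multiple l u -> multiple l (u *~ z).
Proof. by move=> [a ->]; exists (z * a); rewrite -mulrzl rmorphM -mulrA. Qed.

Lemma multiple_sum (I : Type) (r : seq I) (P : pred I) (F : I -> R) :
  (forall i, P i -> multiple l (F i)) -> multiple l (\sum_(i <- r | P i) F i).
Proof. by move=> H; apply: big_ind => //; [exact: multiple0|exact: multipleD]. Qed.

End Congruence.

(** * Integration by parts for piecewise linear functions *)

Section PiecewiseLinear.
Context {R : realType}.
Implicit Types (h : R -> R) (m : int).

(** Two slopes of a germ agree at a common small positive parameter, so the
    slope picked by [germ_slope] is the only one. *)
Lemma germ_slopeE h m (eps : R) : 0 < eps ->
  (forall t, 0 <= t < eps -> h t = h 0 + m%:~R * t) -> germ_slope h = m.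
Proof.
move=> eps0 hm; apply: xget_subset1; first by exists eps.
move=> m1 m2 [e1 e10 h1] [e2 e20 h2].
pose t := Num.min e1 e2 / 2.
have e0 : 0 < Num.min e1 e2 by rewrite lt_min e10.
have t0 : 0 < t by rewrite divr_gt0.
have te : t < Num.min e1 e2 by rewrite /t; lra.
move: te; rewrite lt_min => /andP[te1 te2].
have := h1 t; have := h2 t; rewrite te1 te2 (ltW t0) => -> // /(_ isT).
by move/addrI/(mulIf (lt0r_neq0 t0))/intr_inj.
Qed.

Lemma germ_slope_right h x y m : x < y ->
  (forall t, x <= t <= y -> h t = h x + m%:~R * (t - x)) ->
  germ_slope (fun u => h (x + u)) = m.
Proof.
move=> xy hm; apply: (@germ_slopeE _ _ (y - x)) => [|t /andP[t0 t1]].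
  by rewrite subr_gt0.
by rewrite addr0 hm; [congr (_ + _ * _); lra | apply/andP; split; lra].
Qed.

Lemma germ_slope_left h x y m : x < y ->
  (forall t, x <= t <= y -> h t = h x + m%:~R * (t - x)) ->
  germ_slope (fun u => h (y - u)) = - m.
Proof.
move=> xy hm; apply: (@germ_slopeE _ _ (y - x)) => [|t /andP[t0 t1]].
  by rewrite subr_gt0.
rewrite subr0 (hm (y - t)) ?(hm y); try by apply/andP; split; lra.
rewrite rmorphN /=; ring.
Qed.

(** A piece [y, z] of slope m contributes m psi(y) - m psi(z), where
    psi t = c + beta t.  This is - beta times the increment of h on the piece,
    and the increments telescope. *)
Lemma slopes_by_parts h (c beta : R) (s : seq R) (x L : R) :
    path <%R x (rcons s L) ->
    (forall y z, x <= y -> y <= z -> z <= L ->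
       (forall b, b \in s -> ~~ (y < b < z)) ->
       exists m : int, forall t, y <= t <= z -> h t = h y + m%:~R * (t - y)) ->
  (c + beta * x) *~ germ_slope (fun u => h (x + u)) +
  (c + beta * L) *~ germ_slope (fun u => h (L - u)) +
  \sum_(t <- s) (c + beta * t) *~ (germ_slope (fun u => h (t + u)) +
                                  germ_slope (fun u => h (t - u))) =
  - (beta * (h L - h x)).
Proof.
elim: s x => [|y s IH] x /=.
  rewrite andbT big_nil addr0 => xL H.
  have [//|m hm] := H x L (lexx _) (ltW xL) (lexx _).
  rewrite (germ_slope_right xL hm) (germ_slope_left xL hm).
  rewrite mulrNz -!(mulrzr (_ + _) m) (hm L) ?(ltW xL) ?lexx //; ring.
move=> /andP[xy sL] H.
have yL : y < L.
  by move: sL; rewrite lt_path_sortedE => /andP[/allP /(_ L)];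
    rewrite mem_rcons mem_head => ->.
have [|m hm] := H x y (lexx _) (ltW xy) (ltW yL).
  move=> b; rewrite inE => /orP[/eqP->|bs]; first by rewrite ltxx andbF.
  move: sL; rewrite lt_path_sortedE => /andP[/allP /(_ b)].
  by rewrite mem_rcons inE bs orbT => /(_ isT) yb _; rewrite (ltNge b y) ltW ?andbF.
rewrite big_cons.
have -> : - (beta * (h L - h x)) = - (beta * (h L - h y)) - beta * (h y - h x) by ring.
rewrite -(IH y sL); last first.
  move=> y' z yy' y'z zL Hb; apply: H => //; first exact: le_trans (ltW xy) yy'.
  move=> b; rewrite inE => /orP[/eqP->|]; last exact: Hb.
  by rewrite ltNge yy'.
rewrite (germ_slope_right xy hm) (germ_slope_left xy hm).
rewrite [_ *~ (_ - m)]mulrzBr -!(mulrzr (_ + _) m) (hm y) ?(ltW xy) ?lexx //; ring.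
Qed.

End PiecewiseLinear.

(** * Principal divisors are killed by circulations *)

Section Graph.
Context {R : realType} (G : metric_graph R).
Implicit Types (p : point G) (e : edg G) (D : divisor G).

(** The vertices and the open edges partition the graph into finitely many
    cells, over which a sum over the support of a divisor can be split. *)
Definition cell p : vtx G + edg G :=
  match p with inl v => inl v | inr x => inr (val x).1 end.

Definition pos p : R := if p is inr x then (val x).2 else 0.

Lemma edge_point0 e : edge_point e 0 = inl (src e).
Proof. by rewrite /edge_point insubN ?ltxx //= lexx. Qed.

Lemma edge_point_len e : edge_point e (len e) = inl (tgt e).
Proof.
by rewrite /edge_point insubN /= ?ltxx ?andbF // leNgt len_gt0.
Qed.

Lemma edge_point_in e t (Ht : 0 < t < len e) :
  edge_point e t = inr (exist (fun x : edg G * R => 0 < x.2 < len x.1) (e, t) Ht).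
Proof.
rewrite /edge_point; case: insubP => [x _ xE|]; last by rewrite Ht.
by congr inr; apply: val_inj.
Qed.

Lemma cell_edge_point e t : 0 < t < len e -> cell (edge_point e t) = inr e.
Proof. by move=> Ht; rewrite (edge_point_in Ht). Qed.

Lemma pos_edge_point e t : 0 < t < len e -> pos (edge_point e t) = t.
Proof. by move=> Ht; rewrite (edge_point_in Ht). Qed.

Lemma edge_point_pos p e : cell p = inr e -> edge_point e (pos p) = p.
Proof.
case: p => // -[[e' t] /= Ht] [<-]; rewrite (edge_point_in Ht).
by congr inr; apply: val_inj.
Qed.

Lemma pos_itv p e : cell p = inr e -> 0 < pos p < len e.
Proof. by case: p => // -[[e' t] /= Ht] [<-]. Qed.

Lemma cell_vtx p v : (cell p == inl v) = (p == inl v).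
Proof. by case: p => [u|x] /=; apply/eqP/eqP => // -[->]. Qed.

Definition edge_support D e : seq R := [seq pos p | p <- dom D & cell p == inr e].

Lemma sum_edge_support (M : zmodType) (F : point G -> M) D e :
  \sum_(p <- dom D | cell p == inr e) F p =
  \sum_(t <- edge_support D e) F (edge_point e t).
Proof.
rewrite [RHS]big_map big_filter; apply: eq_bigr => p /eqP ce.
by rewrite edge_point_pos.
Qed.

Lemma edge_support_uniq D e : uniq (edge_support D e).
Proof.
rewrite map_inj_in_uniq ?filter_uniq ?uniq_dom // => p q.
rewrite !mem_filter => /andP[/eqP cp _] /andP[/eqP cq _] pq.
by rewrite -(edge_point_pos cp) pq edge_point_pos.
Qed.

Lemma mem_edge_support D e t :
  (t \in edge_support D e) =
  (0 < t < len e) && (coeff (edge_point e t) D != 0).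
Proof.
apply/mapP/andP => [[p]|[Ht nz]].
  rewrite mem_filter mem_dom => /andP[/eqP ce nz] ->.
  by rewrite pos_itv // edge_point_pos.
exists (edge_point e t); last by rewrite pos_edge_point.
by rewrite mem_filter mem_dom nz cell_edge_point // eqxx.
Qed.

Lemma sum_point (M : zmodType) (phi : point G -> M) D q :
  \sum_(p <- dom D | p == q) phi p *~ coeff p D = phi q *~ coeff q D.
Proof.
rewrite -big_filter; have [qD|qD] := boolP (q \in dom D).
  by rewrite filter_pred1_uniq ?uniq_dom // big_seq1.
rewrite coeff_outdom // mulr0z big1_seq // => p /=.
by rewrite mem_filter => /andP[/eqP->]; rewrite (negbTE qD).
Qed.

Lemma sum_vertex_support (M : zmodType) (phi : point G -> M) D v :
  \sum_(p <- dom D | cell p == inl v) phi p *~ coeff p D =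
  phi (inl v) *~ coeff (inl v) D.
Proof. by rewrite -sum_point; apply: eq_bigl => p; rewrite cell_vtx. Qed.

Lemma linext_cells (M : zmodType) (phi : point G -> M) D :
  linext phi D = \sum_v phi (inl v) *~ coeff (inl v) D +
             \sum_e \sum_(p <- dom D | cell p == inr e) phi p *~ coeff p D.
Proof.
rewrite (linext_split _ cell) big_sumType /=; congr (_ + _).
by apply: eq_bigr => v _; rewrite sum_vertex_support.
Qed.

Lemma ord_interior (f : point G -> R) e t : 0 < t < len e ->
  ord f (edge_point e t) =
  germ_slope (fun u => f (edge_point e (t + u))) +
  germ_slope (fun u => f (edge_point e (t - u))).
Proof. by move=> Ht; rewrite (edge_point_in Ht). Qed.

(** The breakpoints of f may be added to s without changing the sum, since
    the slope of f does not change outside s. *)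
Lemma edge_by_parts (f : point G -> R) e (s : seq R) (c beta : R) :
    rational_function f -> uniq s -> (forall t, t \in s -> 0 < t < len e) ->
    (forall t, 0 < t < len e -> t \notin s -> ord f (edge_point e t) = 0) ->
  c *~ germ_slope (fun u => f (edge_point e u)) +
  (c + beta * len e) *~ germ_slope (fun u => f (edge_point e (len e - u))) +
  \sum_(t <- s) (c + beta * t) *~ ord f (edge_point e t) =
  - (beta * (f (inl (tgt e)) - f (inl (src e)))).
Proof.
move=> ratf Us s_in s_out; have [breaks Hb] := ratf e.
pose s' := sort <=%R (undup [seq b <- breaks ++ s | 0 < b < len e]).
have s'E b : (b \in s') = (0 < b < len e) && ((b \in breaks) || (b \in s)).
  by rewrite mem_sort mem_undup mem_filter mem_cat.
have Us' : uniq s' by rewrite sort_uniq undup_uniq.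
have ps' : path <%R 0 (rcons s' (len e)).
  rewrite -cats1 cat_path /= andbT; apply/andP; split.
    rewrite lt_path_sortedE; apply/andP; split.
      by apply/allP => b; rewrite s'E => /andP[/andP[]].
    by rewrite lt_sorted_uniq_le Us' sort_le_sorted.
  have : last 0 s' \in 0 :: s' by apply: mem_last.
  rewrite inE => /orP[/eqP->|]; first exact: len_gt0.
  by rewrite s'E => /andP[/andP[]].
have := @slopes_by_parts R (fun t => f (edge_point e t)) c beta s' 0 (len e) ps'.
rewrite mulr0 addr0 edge_point0 edge_point_len.
under eq_fun do rewrite add0r.
move=> <-; last first.
  move=> y z y0 yz zL Hyz; apply: Hb => // b bb.
  have [bs|] := boolP (b \in s'); first exact: Hyz.
  rewrite s'E bb /= andbT; apply: contra => /andP[yb bz].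
  by rewrite (le_lt_trans y0 yb) (lt_le_trans bz zL).
congr (_ + _).
rewrite [LHS](_ : _ = \sum_(t <- s' | t \in s)
    (c + beta * t) *~ ord f (edge_point e t)); last first.
  rewrite -[RHS]big_filter; apply: perm_big; apply: uniq_perm => //.
    exact: filter_uniq.
  move=> t; rewrite mem_filter s'E; case: (boolP (t \in s)) => //= ts.
  by rewrite s_in ?orbT.
rewrite big_mkcond /= big_seq [RHS]big_seq; apply: eq_bigr => t.
rewrite s'E => /andP[tL _]; case: ifPn => [_|ts].
  by rewrite ord_interior.
by rewrite -ord_interior // s_out.
Qed.

(** Let f be a function with divisor D - D'.  Integrating by parts on each
    edge, the value of psi on this divisor is minus the integral of beta f',
    which is 0 because beta is orthogonal to differences of potentials, plus
    slopes of f times the discrepancies of psi at the targets of the edges,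
    which lie in l Z. *)
Lemma lin_equiv_linext (psi : point G -> R) (beta : edg G -> R) (l : R) D D' :
    (forall e t, 0 < t < len e ->
       psi (edge_point e t) = psi (inl (src e)) + beta e * t) ->
    (forall e, multiple l (psi (inl (tgt e)) - (psi (inl (src e)) + beta e * len e))) ->
    (forall h : vtx G -> R, \sum_e beta e * (h (tgt e) - h (src e)) = 0) ->
  lin_equiv D D' -> multiple l (linext psi D - linext psi D').
Proof.
move=> psiE psi_multiple circ [f ratf fE].
rewrite -raddfB /= linext_cells.
have -> : \sum_v psi (inl v) *~ coeff (inl v) (D - D') =
   \sum_e (psi (inl (src e)) *~ germ_slope (fun u => f (edge_point e u)) +
     psi (inl (tgt e)) *~ germ_slope (fun u => f (edge_point e (len e - u)))).
  rewrite big_split /= (partition_big (@src R G) predT) //=.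
  rewrite [X in _ = _ + X](partition_big (@tgt R G) predT) //= -big_split /=.
  apply: eq_bigr => v _; rewrite fE /= mulrzDr !mulrz_sumr.
  by congr (_ + _); apply: eq_bigr => e /eqP ->.
rewrite -big_split /=.
rewrite (eq_bigr (fun e => - (beta e * (f (inl (tgt e)) - f (inl (src e)))) +
   (psi (inl (tgt e)) - (psi (inl (src e)) + beta e * len e)) *~
     germ_slope (fun u => f (edge_point e (len e - u))))).
  rewrite big_split /= sumrN (circ (fun v => f (inl v))) oppr0 add0r.
  by apply: multiple_sum => e _; apply: multipleMz.
move=> e _; rewrite sum_edge_support.
rewrite -(@edge_by_parts f e (edge_support (D - D') e) (psi (inl (src e))) (beta e)) //.
- have swap (x y z t : R) : x + y + t = x + z + t + (y - z) by ring.
  rewrite mulrzBl -swap; congr (_ + _).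
  rewrite big_seq [RHS]big_seq; apply: eq_bigr => t.
  by rewrite mem_edge_support => /andP[Ht _]; rewrite psiE // fE.
- exact: edge_support_uniq.
- by move=> t; rewrite mem_edge_support => /andP[].
- move=> t Ht; rewrite mem_edge_support Ht /= negbK => /eqP <-.
  by rewrite fE.
Qed.

Lemma lin_equiv_deg D D' : lin_equiv D D' -> deg D = deg D'.
Proof.
move=> DD'; suff [z] : multiple (0 : R) (linext (fun=> 1) D - linext (fun=> 1) D').
  have degR D0 : linext (fun=> 1) D0 = (deg D0)%:~R :> R.
    rewrite deg_linext /linext rmorph_sum; apply: eq_bigr => p _.
    by rewrite intz.
  by rewrite mulr0 !degR => /eqP; rewrite subr_eq0 => /eqP/intr_inj.
apply: (lin_equiv_linext (beta := fun=> 0)) DD' => [e t _|e|h].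
- by rewrite mul0r addr0.
- by rewrite mul0r addr0 subrr; apply: multiple0.
- by rewrite big1 // => e _; rewrite mul0r.
Qed.

End Graph.

(** * Functions with given slopes *)

Section Gaps.
Context {R : realType}.

Lemma gap_right (s : seq R) (x L : R) : x < L ->
  exists2 y, x < y <= L & forall b, b \in s -> ~~ (x < b < y).
Proof.
move=> xL; elim: s => [|b s [y /andP[xy yL] Hy]]; first by exists L; rewrite ?xL /=.
have [bx|xb] := leP b x.
  exists y => [|b']; first by rewrite xy.
  by rewrite inE => /orP[/eqP->|/Hy //]; rewrite ltNge bx.
exists (Num.min b y) => [|b']; first by rewrite lt_min xb xy ge_min yL orbT.
rewrite inE lt_min => /orP[/eqP->|/Hy]; first by rewrite ltxx /= andbF.
by apply: contra => /and3P[-> _ ->].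
Qed.

Lemma gap_left (s : seq R) (x L : R) : x < L ->
  exists2 y, x <= y < L & forall b, b \in s -> ~~ (y < b < L).
Proof.
move=> xL; elim: s => [|b s [y /andP[xy yL] Hy]]; first by exists x; rewrite ?lexx.
have [Lb|bL] := leP L b.
  exists y => [|b']; first by rewrite xy.
  by rewrite inE => /orP[/eqP->|/Hy //]; rewrite andbC ltNge Lb.
exists (Num.max b y) => [|b']; first by rewrite gt_max bL yL le_max xy orbT.
rewrite inE gt_max => /orP[/eqP->|/Hy]; first by rewrite ltxx.
by apply: contra => /andP[/andP[_ ->] ->].
Qed.

End Gaps.

Section Potential.
Context {R : realType} (G : metric_graph R).
Implicit Types (p : point G) (e : edg G) (D : divisor G).

Definition edge_deg D e : int := \sum_(p <- dom D | cell p == inr e) coeff p D.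

Definition edge_moment D e : R :=
  \sum_(p <- dom D | cell p == inr e) pos p *~ coeff p D.

Section Function.
Context (D : divisor G) (c : edg G -> int) (h : vtx G -> R).

(** The function on e with value h and slope c at the source of e, whose slope
    increases at each point by the coefficient of D there. *)
Definition edge_function e (t : R) : R :=
  h (src e) + (c e)%:~R * t +
  \sum_(p <- dom D | cell p == inr e) Num.max 0 (t - pos p) *~ coeff p D.

Definition graph_function p : R :=
  match p with inl v => h v | inr x => edge_function (val x).1 (val x).2 end.

(** The function max(0, t - b) is affine on every interval that does not
    contain b in its interior. *)
Lemma edge_function_affine e x y :
    (forall b, b \in edge_support D e -> ~~ (x < b < y)) ->
  forall t, x <= t <= y -> edge_function e t = edge_function e x +
    (c e + \sum_(p <- dom D | (cell p == inr e) && (pos p <= x)) coeff p D)%:~R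
      * (t - x).
Proof.
move=> H t /andP[xt ty].
rewrite /edge_function rmorphD /= mulrDl.
rewrite [X in _ = _ + (_ + X)](_ : _ = \sum_(p <- dom D | cell p == inr e)
   (if pos p <= x then (t - x) else 0) *~ coeff p D); last first.
  rewrite big_mkcondr /= rmorph_sum mulr_suml; apply: eq_bigr => p _.
  by case: ifP => _; rewrite ?mulrzl ?mul0rz // rmorph0 mul0r.
have regroup (u v w z k l : R) : w = z + l -> u + v * t + w = u + v * x + z + (v * (t - x) + l).
  by move=> ->; ring.
apply: regroup => //; rewrite -big_split /= big_seq_cond [RHS]big_seq_cond.
apply: eq_bigr => p /andP[pD pe]; rewrite -mulrzDl; congr (_ *~ _).
have : pos p \in edge_support D e by apply: map_f; rewrite mem_filter pe.
move/H; rewrite negb_and -!leNgt; have [px _|xp /= py] := leP (pos p) x.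
  by rewrite !max_r; lra.
by rewrite !max_l; lra.
Qed.

Lemma edge_function0 e : edge_function e 0 = h (src e).
Proof.
rewrite /edge_function mulr0 addr0 big1 ?addr0 // => p /eqP pe.
by have /andP[p0 _] := pos_itv pe; rewrite max_l ?mul0rz //; lra.
Qed.

Lemma edge_function_len e : edge_function e (len e) =
  h (src e) + (c e + edge_deg D e)%:~R * len e - edge_moment D e.
Proof.
rewrite /edge_function rmorphD /= mulrDl addrA -[RHS]addrA; congr (_ + _).
rewrite /edge_deg rmorph_sum mulr_suml /edge_moment -sumrB.
apply: eq_bigr => p /eqP pe; have /andP[_ pl] := pos_itv pe.
by rewrite max_r ?mulrzBl ?mulrzl //; lra.
Qed.

Context (h_tgt : forall e, edge_function e (len e) = h (tgt e)).

Lemma graph_function_edge e t : 0 <= t <= len e ->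
  graph_function (edge_point e t) = edge_function e t.
Proof.
case/andP; rewrite le_eqVlt => /orP[/eqP <- _|t0].
  by rewrite edge_point0 edge_function0.
rewrite le_eqVlt => /orP[/eqP ->|tL]; first by rewrite edge_point_len h_tgt.
by rewrite (@edge_point_in _ _ e t (introT andP (conj t0 tL))).
Qed.

Lemma graph_function_rational : rational_function graph_function.
Proof.
move=> e; exists (edge_support D e) => x y x0 xy yL H.
exists (c e + \sum_(p <- dom D | (cell p == inr e) && (pos p <= x)) coeff p D).
move=> t xty; rewrite !graph_function_edge; first exact: edge_function_affine H t xty.
  by apply/andP; split; lra.
by move/andP: xty => [? ?]; apply/andP; split; lra.
Qed.

Lemma graph_function_right e x : 0 <= x < len e ->
  germ_slope (fun u => graph_function (edge_point e (x + u))) =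
  c e + \sum_(p <- dom D | (cell p == inr e) && (pos p <= x)) coeff p D.
Proof.
move=> /andP[x0 xL]; have [y /andP[xy yL] H] := gap_right (edge_support D e) xL.
apply: (@germ_slope_right _ (fun t => graph_function (edge_point e t)) _ _ _ xy).
move=> t /[dup] /andP[xt ty] xty; rewrite !graph_function_edge; try by apply/andP; split; lra.
exact: edge_function_affine H t xty.
Qed.

Lemma graph_function_left e y : 0 < y <= len e ->
  germ_slope (fun u => graph_function (edge_point e (y - u))) =
  - (c e + \sum_(p <- dom D | (cell p == inr e) && (pos p < y)) coeff p D).
Proof.
move=> /andP[y0 yL]; have [x /andP[x0 xy] H] := gap_left (edge_support D e) y0.
have -> : \sum_(p <- dom D | (cell p == inr e) && (pos p < y)) coeff p D =
          \sum_(p <- dom D | (cell p == inr e) && (pos p <= x)) coeff p D.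
  rewrite big_seq_cond [RHS]big_seq_cond; apply: eq_bigl => p.
  case: (boolP (p \in dom D)) => //= pD; case: (boolP (cell p == inr e)) => //= pe.
  have : pos p \in edge_support D e by apply: map_f; rewrite mem_filter pe.
  move/H; have [px _|xp /=] := leP (pos p) x; last by rewrite -leNgt; lra.
  exact: le_lt_trans px xy.
apply: (@germ_slope_left _ (fun t => graph_function (edge_point e t)) _ _ _ xy).
move=> t /[dup] /andP[xt ty] xty; rewrite !graph_function_edge; try by apply/andP; split; lra.
exact: edge_function_affine H t xty.
Qed.

Lemma ord_graph_function_interior e t : 0 < t < len e ->
  ord graph_function (edge_point e t) = coeff (edge_point e t) D.
Proof.
move=> /[dup] /andP[t0 tL] Ht; rewrite ord_interior //.
rewrite graph_function_right ?tL ?ltW // graph_function_left ?t0 ?ltW //.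
have -> (a b d : int) : a + b - (a + d) = b - d by lia.
rewrite !big_mkcondr -sumrB /=.
have := sum_point (fun=> 1 : int) D (edge_point e t); rewrite intz => <-.
rewrite [RHS](eq_bigl (fun p => (cell p == inr e) && (pos p == t))); last first.
  move=> p; apply/eqP/andP => [->|[/eqP pe /eqP <-]].
    by rewrite cell_edge_point ?pos_edge_point.
  by rewrite edge_point_pos.
rewrite [RHS]big_mkcondr; apply: eq_bigr => p _; rewrite intz.
by case: ltgtP => _; rewrite ?subr0 ?subrr.
Qed.

Lemma ord_graph_function_vtx v : ord graph_function (inl v) =
  \sum_(e | src e == v) c e - \sum_(e | tgt e == v) (c e + edge_deg D e).
Proof.
rewrite /= -sumrN; congr (_ + _); apply: eq_bigr => e _.
  have := @graph_function_right e 0; rewrite lexx len_gt0 => /(_ isT).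
  under eq_fun do rewrite add0r.
  move->; rewrite big1 ?addr0 // => p /andP[/eqP pe].
  by have /andP[p0 _] := pos_itv pe; rewrite leNgt p0.
rewrite graph_function_left ?len_gt0 ?lexx //; congr (- (_ + _)).
apply: eq_bigl => p; case: eqP => //= pe.
by have /andP[_] := pos_itv pe.
Qed.

End Function.

(** The integer c e is the slope at the source of e and c e + edge_deg e the
    slope at its target; the hypotheses say that these slopes integrate to h
    and are balanced by D - D' at the vertices. *)
Lemma potential_lin_equiv D D' (c : edg G -> int) (h : vtx G -> R) :
    (forall e, h (tgt e) = h (src e) +
       (c e + edge_deg (D - D') e)%:~R * len e - edge_moment (D - D') e) ->
    (forall v, coeff (inl v) (D - D') =
       \sum_(e | src e == v) c e - \sum_(e | tgt e == v) (c e + edge_deg (D - D') e)) ->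
  lin_equiv D D'.
Proof.
move=> h_tgt flow; have h_tgt' e : edge_function (D - D') c h e (len e) = h (tgt e).
  by rewrite edge_function_len.
exists (graph_function (D - D') c h); first exact: graph_function_rational.
case=> [v|[[e t] Ht]]; first by rewrite flow ord_graph_function_vtx.
by rewrite -(edge_point_in Ht) ord_graph_function_interior.
Qed.

End Potential.

(** * Abel's theorem for a chain of cycles *)

Section ChainGeometry.
Context {R : realType} {n : nat} (C : chain_of_cycles R n).
Local Notation G := (chain_graph C).
Implicit Types (p : point G) (k : 'I_n.+1) (D : divisor G).

(** Position along the chain: v_k has position k and w_k position k + 1, so
    that a point of position at most k is v_k or lies on its left. *)
Definition loc_vtx (v : chain_vtx C) : nat :=
  match v with
  | inl i => i.+1
  | inr None => 0
  | inr (Some j) => (val j).+1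
  end.

Definition loc_edg (e : chain_edg C) : nat :=
  match e with inl (i, _) => i.+1 | inr j => (val j).+1 end.

Definition loc p : nat :=
  match cell p with inl v => loc_vtx v | inr e => loc_edg e end.

(** The coordinate on the k-th cycle, as a real number: the chain is retracted
    onto the cycle, which sends its left part to v_k, at - arc k, and its right
    part to w_k, at 0. *)
Definition pcoord k p : R :=
  if (loc p <= k)%N then - arc C k
  else if cell p == inr (inl (k, true)) then pos p - arc C k
  else if cell p == inr (inl (k, false)) then pos p
  else 0.

Definition on_cycle k (e : chain_edg C) : R :=
  if e is inl (i, _) then (i == k)%:R else 0.

Lemma loc_chain_v (i : 'I_n.+1) : loc_vtx (chain_v C i) = i.
Proof.
rewrite /chain_v; case: unliftP => [j|] -> //.
by case: insubP => [b _ <-|_] //=; rewrite /bump leq0n.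
Qed.

Lemma pcoord_vtx k (v : chain_vtx C) :
  pcoord k (inl v) = if (loc_vtx v <= k)%N then - arc C k else 0.
Proof. by []. Qed.

Lemma eq_cycle_cell (i k : 'I_n.+1) (b c : bool) :
  ((inr (inl (i, b)) : vtx G + edg G) == inr (inl (k, c))) = (i == k) && (b == c).
Proof. by apply/eqP/andP => [[-> ->]|[/eqP-> /eqP->]]. Qed.

Lemma pcoord_edge_point k (e : edg G) t : 0 < t < len e ->
  pcoord k (edge_point e t) = pcoord k (inl (src e)) + on_cycle k e * t.
Proof.
move=> Ht; rewrite pcoord_vtx /pcoord /loc (cell_edge_point Ht) (pos_edge_point Ht).
case: e Ht => [[i [|]]|j] Ht /=; rewrite ?loc_chain_v ?eq_cycle_cell -?val_eqE /=.
- rewrite andbT andbF; case: ltngtP => //= ik.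
  + by rewrite mul0r addr0.
  + by rewrite mul0r addr0.
  + by rewrite mul1r addrC.
- rewrite andbT andbF; case: ltngtP => //= ik.
  + by rewrite mul0r addr0.
  + by rewrite mul0r addr0.
  + by rewrite mul1r add0r.
- by rewrite mul0r addr0.
Qed.

(** The coordinate is continuous modulo the length of the cycle; it jumps by
    this length where the edge from w_k to v_k ends. *)
Lemma pcoord_tgt k (e : edg G) :
  multiple (cycle_len C k)
    (pcoord k (inl (tgt e)) - (pcoord k (inl (src e)) + on_cycle k e * len e)).
Proof.
rewrite !pcoord_vtx; case: e => [[i [|]]|j] /=; rewrite ?loc_chain_v -?val_eqE /=.
- case: ltngtP => //= ik; rewrite ?mul0r ?addr0 ?subrr; try exact: multiple0.
  by rewrite (val_inj ik) mul1r addNr subrr; apply: multiple0.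
- case: ltngtP => //= ik; rewrite ?mul0r ?addr0 ?subrr; try exact: multiple0.
  by exists (-1); rewrite (val_inj ik); ring.
- by rewrite /bump leq0n mul0r addr0 subrr; apply: multiple0.
Qed.

Lemma sum_chain_edg (M : zmodType) (F : chain_edg C -> M) :
  \sum_e F e = \sum_i (F (inl (i, true)) + F (inl (i, false))) + \sum_j F (inr j).
Proof.
rewrite big_sumType /=; congr (_ + _).
rewrite (eq_bigr (fun ib => F (inl (ib.1, ib.2)))); last by case.
rewrite -(pair_bigA _ (fun i b => F (inl (i, b)))) /=.
by apply: eq_bigr => i _; rewrite big_bool.
Qed.

Lemma on_cycle_closed k (h : vtx G -> R) :
  \sum_(e : edg G) on_cycle k e * (h (tgt e) - h (src e)) = 0.
Proof.
rewrite sum_chain_edg /= big1 ?add0r => [|i _]; last by ring.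
by rewrite big1 // => j _; rewrite mul0r.
Qed.

(** Integrate d from v_0 along the clockwise edges from v_i to w_i and the
    bridges; the hypothesis is what is needed on the remaining edges. *)
Lemma exact_chain (d : chain_edg C -> R) :
  (forall i, d (inl (i, true)) + d (inl (i, false)) = 0) -> @exact R G d.
Proof.
move=> cyc.
pose u (a b : nat) : R := \sum_(i < n.+1 | (i < a)%N) d (inl (i, true)) +
  \sum_(j : true_bridge C | (val j < b)%N) d (inr j).
pose h (v : chain_vtx C) : R := match v with
  | inl i => u i.+1 i
  | inr None => 0
  | inr (Some j) => u (val j).+1 (val j).+1
  end.
have hv (i : 'I_n.+1) : h (chain_v C i) = u i i.
  rewrite /chain_v; case: unliftP => [j|] -> /=; last by rewrite /u !big_pred0 ?addr0.
  rewrite /bump leq0n add1n; case: insubP => [b _ <-|nj] //=.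
  congr (_ + _); apply: eq_bigl => b.
  apply/idP/idP => [/ltnW //|]; rewrite ltnS ltn_neqAle => ->; rewrite andbT.
  by apply/eqP => bj; move: nj; rewrite -(val_inj bj) (valP b).
exists h => -[[i [|]]|j] /=.
- rewrite hv /u (bigD1 i) ?ltnSn //=.
  rewrite (eq_bigl (fun i' : 'I_n.+1 => (i' < i)%N)); first by ring.
  by move=> i'; rewrite ltnS leq_eqVlt -val_eqE /=; case: ltngtP.
- have /eqP := cyc i; rewrite addrC addr_eq0 => /eqP ->.
  rewrite hv /u [X in _ = _ - (X + _)](bigD1 i) ?ltnSn //=.
  rewrite [X in _ = _ - (_ + X + _)](eq_bigl (fun i' : 'I_n.+1 => (i' < i)%N)); first by ring.
  by move=> i'; rewrite ltnS leq_eqVlt -val_eqE /=; case: ltngtP.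
- rewrite hv /= /bump leq0n add1n /u.
  rewrite [X in _ = _ + X - _](bigD1 j) ?ltnSn //=.
  rewrite [X in _ = _ + (_ + X) - _](eq_bigl (fun j' : true_bridge C =>
    (val j' < val j)%N)); first by ring.
  by move=> j'; rewrite ltnS leq_eqVlt -val_eqE /= -val_eqE; case: ltngtP.
Qed.

Definition coord k D : R := linext (pcoord k) D.

(** The number of chips at v_i and on its left.  By conservation of flow, a
    function with divisor D has total slope [left_deg i D] from v_i into the
    i-th cycle. *)
Definition left_deg (i : nat) D : int := linext (fun p => (loc p <= i)%N%:Z) D.

(** The chips on the left sit at - a_k, and a chip on the edge from v_k to w_k
    at - a_k plus its distance from v_k. *)
Lemma coordE k D : coord k D =
  edge_moment D (inl (k, true)) + edge_moment D (inl (k, false))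
  - (left_deg k D + edge_deg D (inl (k, true)))%:~R * arc C k.
Proof.
have cyc_right (p : point G) b : cell p == inr (inl (k, b) : edg G) -> (loc p <= k)%N = false.
  by move/eqP => pe; rewrite /loc pe /= ltnn.
rewrite /coord /left_deg /linext /edge_moment /edge_deg.
rewrite [X in _ = X + _ - _]big_mkcond [X in _ = _ + X - _]big_mkcond.
rewrite [X in _ - (_ + X)%:~R * _]big_mkcond /= -big_split /=.
rewrite -!big_split /= rmorph_sum mulr_suml -sumrB; apply: eq_bigr => p _.
rewrite /pcoord; have := cyc_right p; case: (boolP (loc p <= k)%N) => [lp cr|lp _].
  rewrite !ifN; try by apply: contraT; rewrite negbK => /cr.
  by rewrite !addr0 add0r intz mulNrz mulrzl.
rewrite mul0rz add0r.
case: ifPn => [/eqP pe|_].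
  by rewrite pe eq_cycle_cell andbF addr0 mulrzBl mulrzl.
rewrite rmorph0 mul0r subr0 add0r.
by case: ifP => _; rewrite ?mul0rz.
Qed.

Definition bridge_deg (i : nat) D : int := \sum_(j : true_bridge C | val j == i :> nat)
   (edge_deg D (inr j) + coeff (inl (inr (Some j))) D).

(** All the chips up to w_i: the slope at w_i, along the bridge that leaves it,
    of a function with divisor D. *)
Definition cycle_deg (i : 'I_n.+1) D : int :=
  left_deg i D + edge_deg D (inl (i, true)) + edge_deg D (inl (i, false)) +
  coeff (inl (inl i)) D.

Lemma left_deg0 D : left_deg 0 D = coeff (inl (inr None)) D.
Proof.
rewrite /left_deg linext_cells [X in _ + X]big1 ?addr0 => [|e _]; last first.
  apply: big1 => p /eqP pe; rewrite /loc pe /=.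
  by case: e pe => [[i b]|j] pe; rewrite /= mul0rz.
rewrite (bigD1 (inr None : chain_vtx C)) //= intz big1 ?addr0 //.
by case=> [i|[j|]] // _; rewrite mul0rz.
Qed.

Lemma sum_chain_vtx (M : zmodType) (F : chain_vtx C -> M) :
  \sum_v F v = \sum_i F (inl i) + (F (inr None) + \sum_j F (inr (Some j))).
Proof.
rewrite big_sumType /=; congr (_ + _); rewrite (bigD1 None) //=; congr (_ + _).
rewrite (reindex_omap Some id) /=; last by case.
by apply: eq_bigl => j; rewrite eqxx.
Qed.

Lemma left_degS (i : 'I_n.+1) D : left_deg i.+1 D = cycle_deg i D + bridge_deg i D.
Proof.
have -> : left_deg i.+1 D = left_deg i D + linext (fun p => (loc p == i.+1)%N%:Z) D.
  rewrite /left_deg /linext -big_split /=; apply: eq_bigr => p _.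
  rewrite -mulrzDl; congr (_ *~ _).
  have -> : (loc p <= i)%N = (loc p < i.+1)%N by [].
  by case: ltngtP.
rewrite /cycle_deg /bridge_deg big_split /= -!addrA; congr (_ + _).
rewrite linext_cells sum_chain_vtx.
have -> : \sum_(e : edg G) \sum_(p <- dom D | cell p == inr e)
    (loc p == i.+1)%N%:Z *~ coeff p D =
  \sum_(e : edg G) (loc_edg e == i.+1)%N%:Z *~ edge_deg D e.
  apply: eq_bigr => e _; rewrite /edge_deg mulrz_sumr.
  by apply: eq_bigr => p /eqP pe; rewrite /loc pe.
rewrite sum_chain_edg /= mul0rz add0r.
have pick (M : zmodType) (F : 'I_n.+1 -> M) (H : forall k, k != i -> F k = 0) :
    \sum_k F k = F i.
  by rewrite (bigD1 i) //= big1 ?addr0.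
rewrite !pick; last first.
- by move=> k ki; rewrite /loc /= eqSS val_eqE (negbTE ki) mul0rz.
- by move=> k ki; rewrite eqSS val_eqE (negbTE ki) !mul0rz addr0.
rewrite /loc /= eqxx !intz.
have cond (F : true_bridge C -> int) :
    \sum_(j : true_bridge C) ((sval j).+1 == i.+1)%N%:Z *~ F j =
    \sum_(j : true_bridge C | sval j == i :> nat) F j.
  rewrite [RHS]big_mkcond; apply: eq_bigr => j _.
  by rewrite eqSS; case: eqP; rewrite ?intz ?mul0rz.
by rewrite !cond; ring.
Qed.

Lemma left_deg_deg i D : (n < i)%N -> left_deg i D = deg D.
Proof.
move=> ni; rewrite deg_linext; apply: eq_bigr => p _; congr (_ *~ _).
rewrite (_ : (loc p <= i)%N = true) //=; apply: leq_trans ni.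
rewrite /loc; case: (cell p) => [[k|[j|]]|[[k b]|j]] //=.
- exact: leq_trans (ltn_ord (val j)) _.
- exact: leq_trans (ltn_ord (val j)) _.
Qed.

Lemma bridge_deg_val (j : true_bridge C) D :
  bridge_deg (sval j) D = edge_deg D (inr j) + coeff (inl (inr (Some j))) D.
Proof.
rewrite /bridge_deg (bigD1 j) //= big1 ?addr0 // => j' /andP[/eqP jj' nj].
by rewrite (val_inj (val_inj jj')) eqxx in nj.
Qed.

Lemma bridge_deg_out (i : nat) D :
  (forall j : true_bridge C, sval j != i :> nat) -> bridge_deg i D = 0.
Proof. by move=> H; rewrite /bridge_deg big1 // => j; rewrite (negbTE (H j)). Qed.

Lemma chain_v_bridge (j : true_bridge C) :
  chain_v C (lift ord0 (val j)) = inr (Some j).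
Proof. by rewrite /chain_v liftK valK. Qed.

Lemma chain_v_nobridge (j : 'I_n) : ~~ (0 < bridge C j) ->
  chain_v C (lift ord0 j) = chain_w C (widen_ord (leqnSn n) j).
Proof. by move=> nj; rewrite /chain_v liftK insubN. Qed.

(** A bridge of length 0 is not an edge, so it must contribute 0. *)
Lemma sum_true_bridge (M : zmodType) (F : 'I_n -> M) :
  (forall j, ~~ (0 < bridge C j) -> F j = 0) ->
  \sum_j F j = \sum_(j : true_bridge C) F (val j).
Proof.
move=> F0; rewrite [RHS](partition_big val predT) //=; apply: eq_bigr => j _.
have [j0|/[dup] nj /F0 ->] := boolP (0 < bridge C j).
  rewrite (bigD1 (Sub j j0 : true_bridge C)) ?SubK //= big1 ?addr0 //.
  move=> j' /andP[/eqP jj']; case/negP; apply/eqP/val_inj.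
  by rewrite SubK; apply: jj'.
by rewrite big1 // => j' /eqP jj'; rewrite -jj' (valP j') in nj.
Qed.

(** In the converse the slopes on the bridges, and the difference of the slopes
    on the two edges of a cycle, are given by conservation of flow.  There
    remains one integer for each cycle: the quotient of the coordinate of
    D - D' by the length of the cycle makes the function single-valued. *)
Lemma lin_equivP D D' : lin_equiv D D' <->
  deg D = deg D' /\ forall k, multiple (cycle_len C k) (coord k D - coord k D').
Proof.
split=> [DD'|[degDD' coordDD']].
  split; first exact: lin_equiv_deg DD'.
  move=> k; apply: (@lin_equiv_linext R G (pcoord k) (on_cycle k) _ D D') DD'.
  - by move=> e t; apply: pcoord_edge_point.
  - exact: pcoord_tgt.
  - exact: on_cycle_closed.
set D0 := D - D'.
have deg0 : deg D0 = 0 by rewrite degB degDD' subrr.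
have /boolp.choice[z Hz] k : exists z : int, coord k D0 = z%:~R * cycle_len C k.
  by have [z Hz] := coordDD' k; exists z; rewrite -Hz -raddfB.
(* z i is the slope on the edge from w_i to v_i, at its end. *)
pose c (e : edg G) : int := match (e : chain_edg C) with
  | inl (i, true) => z i + left_deg i D0
  | inl (i, false) => z i - edge_deg D0 (inl (i, false))
  | inr j => cycle_deg (widen_ord (leqnSn n) (val j)) D0
  end.
have [h Hh] : @exact R G (fun e => (c e + edge_deg D0 e)%:~R * len e - edge_moment D0 e).
  apply: exact_chain => i; have := Hz i; rewrite coordE /c /=.
  rewrite subrK !rmorphD /= => H.
by lra.
apply: (potential_lin_equiv (c := c) (h := h)) => [e|v0].
  by have := Hh e; lra.
(* Paired with the indicator g of v0, the sums over edges incident to v0 become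
   sums over all edges, which telescope along the chain. *)
pose g (v : vtx G) : int := (v == v0)%:R.
transitivity (\sum_(v : vtx G) coeff (inl v) D0 * g v).
  by rewrite (bigD1 v0) //= /g eqxx mulr1 big1 ?addr0 // => v /negbTE ->; rewrite mulr0.
transitivity (\sum_e c e * g (src e) - \sum_e (c e + edge_deg D0 e) * g (tgt e)); last first.
  rewrite [X in _ = X - _]big_mkcond [X in _ = _ - X]big_mkcond.
  by congr (_ - _); apply: eq_bigr => e _; rewrite /g; case: eqP => _; rewrite ?mulr1 ?mulr0.
rewrite sum_chain_vtx !sum_chain_edg /=.
pose w (i : 'I_n.+1) := g (chain_w C i); pose v (i : 'I_n.+1) := g (chain_v C i).
pose low (j : 'I_n) := widen_ord (leqnSn n) j.
have last0 : cycle_deg ord_max D0 = 0.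
  have := left_deg_deg D0 (ltnSn n); rewrite deg0 (left_degS ord_max).
  by rewrite bridge_deg_out ?addr0 // => j; rewrite neq_ltn ltn_ord.
have telescope : \sum_(i < n.+1) left_deg i D0 * v i - \sum_i cycle_deg i D0 * w i =
    left_deg 0 D0 * v ord0 + \sum_(j : true_bridge C)
     (cycle_deg (low (val j)) D0 * (v (lift ord0 (val j)) - w (low (val j))) +
      bridge_deg (val j) D0 * v (lift ord0 (val j))).
  rewrite big_ord_recl big_ord_recr /= last0 mul0r addr0 -addrA; congr (_ + _).
  rewrite -(@sum_true_bridge _ (fun j => cycle_deg (low j) D0 *
    (v (lift ord0 j) - w (low j)) + bridge_deg j D0 * v (lift ord0 j))).
    rewrite -sumrB; apply: eq_bigr => j _.
    by rewrite /= /bump leq0n add1n (left_degS (low j)) /w /=; ring.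
  move=> j nj; rewrite /v chain_v_nobridge // /w /low subrr mulr0 add0r.
  rewrite bridge_deg_out ?mul0r // => j'; apply/eqP => jj'.
  by move: nj; rewrite -(val_inj jj') (valP j').
have chips : \sum_(i < n.+1)
     ((z i + left_deg i D0) * v i + (z i - edge_deg D0 (inl (i, false))) * w i) -
   \sum_(i < n.+1)
     ((z i + left_deg i D0 + edge_deg D0 (inl (i, true))) * w i +
      (z i - edge_deg D0 (inl (i, false)) + edge_deg D0 (inl (i, false))) * v i) =
   \sum_(i < n.+1) left_deg i D0 * v i - \sum_i cycle_deg i D0 * w i +
   \sum_i coeff (inl (inl i)) D0 * w i.
  rewrite -!sumrB -big_split; apply: eq_bigr => i _; rewrite /cycle_deg /=; ring.
rewrite opprD addrACA chips telescope left_deg0 -sumrB.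
have v0E : v ord0 = g (inr None) by rewrite /v /chain_v unlift_none.
have regroup (a b s t u : int) : s = t + u -> a + (b + s) = b + t + a + u by lia.
rewrite v0E; apply: regroup; rewrite -big_split /=.
apply: eq_bigr => j _; rewrite bridge_deg_val /v chain_v_bridge /w /low /=; ring.
Qed.

End ChainGeometry.

(** * Growth of the partition of a class *)

Section Dynamics.
Context {R : realType} (a l : nat -> R).
Implicit Types (x y : nat -> R) (i j r t : nat).

(** Seen from the j-th cycle, t chips on its left have coordinate - t a_j: no
    chip is needed on the cycle when this is already x_j modulo l_j. *)
Definition lingers x j t : bool := `[< multiple (l j) (x j + t%:R * a j) >].

Fixpoint min_chips x j : nat :=
  if j is i.+1 then (min_chips x i + ~~ lingers x i (min_chips x i))%N else 0%N.

(** The partition after j cycles, as the function giving the length of each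
    row.  The number r + j - rows x j r is the largest total of chips, needed
    or removed, on the left of cycle j when r of them are removed in the least
    favourable way. *)
Fixpoint rows x j (r : nat) : nat :=
  if j is i.+1 then
    (rows x i r + (((r == 0) || (rows x i r < rows x i r.-1)) &&
                   lingers x i (r + i - rows x i r)))%N
  else 0%N.

Definition agree j x y := forall i, (i < j)%N -> multiple (l i) (x i - y i).

Lemma lingers_agree j x y t : multiple (l j) (x j - y j) -> lingers x j t = lingers y j t.
Proof.
move=> xy; apply/asboolP/asboolP => H.
  by rewrite -[y j](subKr (x j)) addrAC; apply: multipleB.
by rewrite -[x j](subrK (y j)) -addrA; apply: multipleD.
Qed.

Lemma agreeW i j x y : (i <= j)%N -> agree j x y -> agree i x y.
Proof. by move=> ij H k ki; apply: H; apply: leq_trans ij. Qed.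

Lemma min_chips_agree j x y : agree j x y -> min_chips x j = min_chips y j.
Proof.
elim: j => //= j IH xy; rewrite IH; last exact: agreeW xy.
by rewrite (@lingers_agree _ _ y) //; apply: xy.
Qed.

Lemma rows_agree j x y : agree j x y -> rows x j =1 rows y j.
Proof.
elim: j => //= j IH xy r; rewrite !IH; try exact: agreeW xy.
by rewrite (@lingers_agree _ _ y) //; apply: xy.
Qed.

Lemma rows_le x j r : (rows x j r <= j)%N.
Proof. by elim: j => //= j IH; case: (_ && _); lia. Qed.

Lemma rows_mono x j r : (rows x j r <= rows x j.+1 r)%N.
Proof. exact: leq_addr. Qed.

Lemma rows_le_mono x i j r : (i <= j)%N -> (rows x i r <= rows x j r)%N.
Proof.
move=> ij; rewrite -(subnK ij); elim: (j - i)%N => // k IH.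
exact: leq_trans IH (rows_mono _ _ _).
Qed.

Lemma rows_noninc x j r : (rows x j r.+1 <= rows x j r)%N.
Proof.
elim: j => //= j IH.
case: (boolP (rows x j r.+1 < rows x j r)%N) => [lt|ge] /=; last lia.
by case: lingers; case: (_ && _); lia.
Qed.

Lemma rows_noninc_le x j r r' : (r <= r')%N -> (rows x j r' <= rows x j r)%N.
Proof.
move=> rr'; rewrite -(subnK rr'); elim: (r' - r)%N => // k IH.
exact: leq_trans (rows_noninc _ _ _) IH.
Qed.

(** A row is started after the one above it, and a cycle adds at most one box
    to each row. *)
Lemma rows0 x j r : (j <= r)%N -> rows x j r = 0%N.
Proof.
elim: j r => //= j IH r jr; rewrite (IH r) ?(ltnW jr) // (IH r.-1); last lia.
by case: r jr.
Qed.

(** The growth is monotone: if a box can be added to a smaller partition, then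
    either it already belongs to the larger one or it can be added to it too. *)
Lemma rows_add x j r (mu : nat -> nat) :
    (forall r, mu r <= rows x j r)%N -> (r == 0) || (mu r < mu r.-1)%N ->
    lingers x j (r + j - mu r) ->
  (mu r < rows x j.+1 r)%N.
Proof.
move=> mu_le corner ling /=.
have := mu_le r; rewrite leq_eqVlt => /orP[/eqP mur|]; last lia.
rewrite -mur ling andbT -ltnS -addn1 leq_add2l lt0b.
by case/orP: corner => [->//|mu_lt]; rewrite (leq_trans mu_lt (mu_le _)) orbT.
Qed.

(** The cycle can add a box to some partition.  Before cycle i there are at most
    i non-empty rows, so that the boxes that can be added have t <= 2 i. *)
Definition special x i : bool := [exists t : 'I_(2 * i).+1, lingers x i t].

Lemma lingers_diff x j t t' : (t <= t')%N -> lingers x j t -> lingers x j t' ->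
  multiple (l j) ((t' - t)%:R * a j).
Proof.
move=> tt' /asboolP Ht /asboolP Ht'; have := multipleB Ht' Ht.
by rewrite natrB //; congr multiple; ring.
Qed.

Section LargeTorsion.
Context (N : nat).
Context (large : forall j d, (0 < j < N)%N -> (0 < d <= j.+1)%N ->
                   ~ multiple (l j) (d%:R * a j)).

(** If a box can be added to row r' then the rows between r and r' are not
    empty; with row r itself they give a hook contained in mu. *)
Lemma hook_le (mu : nat -> nat) (M r r' : nat) :
    (forall i, mu i.+1 <= mu i)%N -> (r < r' < M)%N -> (mu r' < mu r'.-1)%N ->
  (mu r + (r' - r.+1) <= \sum_(i < M) mu i)%N.
Proof.
move=> dec /andP[rr' r'M] lt_mu.
have le_mu i : (i < r')%N -> (0 < mu i)%N.
  move=> ir'; apply: leq_ltn_trans (leq0n (mu r')) _; apply: (leq_trans lt_mu).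
  have : (i <= r'.-1)%N by lia.
  move=> le_i; rewrite -(subnK le_i); elim: (r'.-1 - i)%N => // k IH.
  exact: leq_trans (dec _) IH.
have rM : (r <= M)%N := ltnW (ltn_trans rr' r'M).
have r'M' := ltnW r'M; have rr'' := ltnW rr'.
rewrite -(big_mkord xpredT mu) (big_cat_nat (n := r)) //=.
rewrite (big_cat_nat (n := r') (m := r)) //=.
rewrite [X in (_ <= _ + (X + _))%N]big_ltn //.
have : (\sum_(r.+1 <= i < r') 1 <= \sum_(r.+1 <= i < r') mu i)%N.
  by rewrite !big_nat; apply: leq_sum => i /andP[_]; apply: le_mu.
rewrite sum_nat_const_nat muln1; lia.
Qed.

(** If boxes are added to rows r < r' on the same cycle j, their numbers of
    chips differ by some d > 0 such that d a_j is a multiple of l_j.  By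
    [hook_le], d is at most one more than the number of boxes, which is at most
    j by induction; this contradicts [large].  On the first cycle only row 0 can
    receive a box. *)
Lemma sum_rows_le x j M : (j <= N)%N ->
  (\sum_(r < M) rows x j r <= \sum_(i < j) special x i)%N.
Proof.
elim: j => [|j IH] jN /=; first by rewrite big1.
rewrite big_split big_ord_recr /= leq_add ?IH ?(ltnW jN) //.
pose P r := ((r == 0) || (rows x j r < rows x j r.-1))%N &&
  lingers x j (r + j - rows x j r).
change (\sum_(r < M) P r <= special x j)%N.
have P_le r : P r -> (r <= j)%N.
  rewrite leqNgt /P; case: r => //= r /andP[+ _].
  by apply: contraL => jr; rewrite (@rows0 x j r).
have P_special r : P r -> special x j.
  move=> Pr; have rj := P_le r Pr; move: Pr => /andP[_ ling].
  have t_lt : (r + j - rows x j r < (2 * j).+1)%N by lia.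
  by apply/existsP; exists (Ordinal t_lt).
have P_uniq r r' : (r < M)%N -> (r' < M)%N -> P r -> P r' -> (r < r')%N -> False.
  move=> rM r'M /andP[_ Hr] /andP[/orP[/eqP->//|lt_r'] Hr'] rr'.
  have hook : (rows x j r + (r' - r.+1) <= j)%N.
    apply: (leq_trans (@hook_le (rows x j) M r r' _ _ _)) => //.
    - exact: rows_noninc.
    - by rewrite rr'.
    apply: leq_trans (IH (ltnW jN)) _.
    by rewrite -[leqRHS](card_ord j) -sum1_card leq_sum // => i _; apply: leq_b1.
  have le_r := rows_noninc_le x j (ltnW rr').
  have := rows_le x j r; have := rows_le x j r' => le_r'j le_rj.
  have le_t : (r + j - rows x j r <= r' + j - rows x j r')%N by lia.
  apply: (@large j _ _ _ (lingers_diff le_t Hr Hr')); last lia.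
  by rewrite jN andbT; case: (j) lt_r'.
case: (boolP (special x j)) => [_|nsp]; last first.
  by rewrite big1 // => r _; case: (boolP (P r)) => // /P_special sp; rewrite sp in nsp.
rewrite -big_mkcond /= sum1_card; apply/card_le1_eqP => r r'.
rewrite !unfold_in => Pr Pr'; apply: val_inj => /=.
by case: (ltngtP r r') => // [/(P_uniq _ _ _ _ Pr Pr')|/(P_uniq _ _ _ _ Pr' Pr)] [].
Qed.

End LargeTorsion.

End Dynamics.

(** * Filling partitions *)

Section Filling.
Context {R : realType} (a l : nat -> R).
Implicit Types (x y : nat -> R) (i j r t : nat).
Local Notation rows := (rows a l).
Local Notation lingers := (lingers a l).

Lemma lingers_of_multiple x j t : multiple (l j) (x j - - (t%:R * a j)) -> lingers x j t.
Proof. by rewrite opprK => H; apply/asboolP. Qed.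

(** The boxes are added row by row, and the coordinate of each cycle is
    adjusted to the box that it adds. *)
Lemma fill_partition (lam : seq nat) : sorted geq lam ->
  exists y, forall x, agree l (sumn lam) x y ->
    forall r, (nth 0%N lam r <= rows x (sumn lam) r)%N.
Proof.
elim/last_ind: lam => [|s c IH] sorted_s.
  by exists (fun=> 0) => x _ r; rewrite nth_nil.
rewrite sumn_rcons; elim: c sorted_s => [|c IHc] sorted_c.
  have [|y Hy] := IH.
    by move: sorted_c; rewrite -cats1 => /cat_sorted2[].
  exists y => x; rewrite addn0 => /Hy {}Hy r; rewrite nth_rcons.
  by case: ltngtP => //; rewrite ?leq0n // => rs; apply: Hy.
have le_c r : (r < size s)%N -> (c.+1 <= nth 0%N s r)%N.
  move=> rs; have := sorted_c; rewrite -cats1 sorted_pairwise; last first.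
    by move=> u v w uv vw; apply: leq_trans vw uv.
  rewrite pairwise_cat => /and3P[+ _ _]; rewrite allrel1r => /allP; apply.
  exact: mem_nth.
have [|y Hy] := IHc.
  move: sorted_c; rewrite !sorted_pairwise; try by move=> u v w uv vw; apply: leq_trans vw uv.
  rewrite -!cats1 !pairwise_cat !allrel1r => /and3P[_ ps _].
  by apply/and3P; split=> //; apply/allP => b /(nthP 0%N)[r rs <-]; apply/ltnW/le_c.
set j := (sumn s + c)%N in Hy; rewrite addnS -/j.
exists (fun i => if i == j then - ((size s + j - c)%:R * a j) else y i) => x Hx.
have {}Hy : forall r, (nth 0%N (rcons s c) r <= rows x j r)%N.
  by apply: Hy => i ij; have := Hx i (ltnW ij); rewrite ltn_eqF.
have ling : lingers x j (size s + j - c).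
  by apply: lingers_of_multiple; have := Hx j (ltnSn j); rewrite eqxx.
have nth_s : nth 0%N (rcons s c) (size s) = c by rewrite nth_rcons ltnn eqxx.
move=> r; rewrite nth_rcons; case: ltngtP => [rs|//|->].
  apply: leq_trans (rows_mono _ _ _ _ _); have := Hy r.
  by rewrite nth_rcons rs.
rewrite -{1}nth_s; apply: rows_add => //; last by rewrite nth_s.
case: (posnP (size s)) => [-> //|s0]; rewrite nth_s nth_rcons.
have lt_s : ((size s).-1 < size s)%N by rewrite prednK.
by rewrite lt_s le_c ?orbT.
Qed.

(** A column of height m - 1 with a box added at both of its corners. *)
Definition hook (m : nat) : seq nat := 2%N :: nseq m.-1 1%N.

(** The m - 1 cycles before cycle i fill a column.  The numbers of chips at its
    two corners differ by m, so that the coordinate of cycle i can be adjusted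
    to both at once. *)
Lemma fill_hook (i m : nat) : (1 < m <= i.+1)%N -> multiple (l i) (m%:R * a i) ->
  exists y, forall x,
    (forall j, (i < j + m)%N -> (j <= i)%N -> multiple (l j) (x j - y j)) ->
    forall r, (nth 0%N (hook m) r <= rows x i.+1 r)%N.
Proof.
move=> /andP[m1 mi] m_tors; pose j0 := (i.+1 - m)%N.
(* Box of row j - j0 in column 0 before cycle i; on cycle i, box of row 0 in column 1. *)
pose y j := if j == i then - (i.-1%:R * a i) else - ((j - j0 + j)%:R * a j).
exists y => x Hx.
have column c : (c < m)%N -> forall r, ((r < c) <= rows x (j0 + c) r)%N.
  elim: c => [|c IH] cm r //; rewrite addnS.
  have {}IH := IH (ltnW cm).
  have ne_i : (j0 + c == i) = false by rewrite /j0; lia.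
  have ling : lingers x (j0 + c) (c + (j0 + c) - (c < c)%N).
    apply: lingers_of_multiple; have := Hx (j0 + c)%N; rewrite /y ne_i addKn ltnn subn0.
    by apply; rewrite /j0; lia.
  rewrite ltnS [(r <= c)%N]leq_eqVlt.
  case: eqP => [->|_]; last exact: leq_trans (IH r) (rows_mono _ _ _ _ _).
  have := @rows_add _ a l x (j0 + c) c (fun r => (r < c)%N : nat) IH.
  rewrite ltnn => ->//; last by rewrite -[X in (_ - X)%N]/(nat_of_bool false) -(ltnn c).
  by case: (c) => //= c'; rewrite ltnS leqnn.
have := column m.-1; rewrite ltn_predL => /(_ (ltnW m1)).
have -> : (j0 + m.-1 = i)%N by rewrite /j0; lia.
move=> col; have ling0 : lingers x i i.-1.
  by apply: lingers_of_multiple; have := Hx i; rewrite /y eqxx; apply; lia.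
have lingm : lingers x i (m.-1 + i).
  apply/asboolP; move/asboolP: ling0 => /multipleD/(_ m_tors); congr multiple.
  rewrite -addrA -mulrDl -natrD; congr (_ + _%:R * _); lia.
have add := @rows_add _ a l x i _ (fun r => (r < m.-1)%N : nat) col.
have m0 : (0 < m.-1)%N by lia.
case=> [|r].
  have : ((0 < m.-1) < rows x i.+1 0)%N by apply: add; rewrite // m0 add0n subn1.
  by rewrite m0.
rewrite -[nth _ _ _]/(nth 0%N (nseq m.-1 1%N) r) nth_nseq; case: ltnP => // rm.
have [rm'|rm'] := ltnP r.+1 m.-1.
  by apply: leq_trans (rows_mono _ _ _ _ _); have := col r.+1; rewrite rm'.
have -> : r.+1 = m.-1 by lia.
have : ((m.-1 < m.-1) < rows x i.+1 m.-1)%N.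
  by apply: add; rewrite ltnn ?subn0 // ltn_predL m0 orbT.
by rewrite ltnn.
Qed.

End Filling.

(** * Effective classes and rank *)

Section Rank.
Context {R : realType} {n : nat} (C : chain_of_cycles R n).
Local Notation G := (chain_graph C).
Implicit Types (D E : divisor G) (p : point G) (k : 'I_n.+1) (i j r : nat)
  (x : nat -> R).

(** The recursions above run over nat; only the indices below n.+1 are
    meaningful. *)
Definition arcs i : R := arc C (inord i).
Definition lens i : R := cycle_len C (inord i).
Definition coords D i : R := coord (inord i) D.

Local Notation lingers := (lingers arcs lens).
Local Notation min_chips := (min_chips arcs lens).
Local Notation rows := (rows arcs lens).

Lemma cycle_len_gt0 k : 0 < cycle_len C k.
Proof. by have /andP[] := arc_itv C k; apply: lt_trans. Qed.

Lemma pcoord_far k p : loc p != k.+1 -> pcoord k p = - arc C k *~ (loc p <= k)%N%:Z.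
Proof.
rewrite /pcoord; case: leqP => _ // Hk.
by rewrite !ifN //; apply: contra Hk => /eqP pk; rewrite /loc pk.
Qed.

Lemma pcoord_vtx_right k (v : chain_vtx C) : (k < loc_vtx v)%N -> pcoord k (inl v) = 0.
Proof. by rewrite pcoord_vtx ltnNge => /negbTE ->. Qed.

(** A point of the k-th cycle has coordinate 0 on every cycle on its left, so
    that the coordinates can be prescribed one after the other. *)
Lemma pcoord_surj k (y : R) : exists p, [/\ (loc p <= k.+1)%N,
  forall i : 'I_n.+1, (i < k)%N -> pcoord i p = 0 & multiple (cycle_len C k) (pcoord k p - y)].
Proof.
have l0 := cycle_len_gt0 k; have /andP[a0 al] := arc_itv C k.
set l := cycle_len C k in l0 al *; set b := arc C k in a0 al *.
(* t is the representative of y in [0, l).  It is reached on the edge from w_k to v_k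
   if t < l - b, and on the other edge if t > l - b. *)
pose z := Num.floor (y / l); pose t := y - z%:~R * l.
have t0 : 0 <= t by rewrite /t subr_ge0 -ler_pdivlMr // floor_le.
have tl : t < l.
  have := floorD1_gt (y / l); rewrite ltr_pdivrMr // rmorphD /=.
  by rewrite /t /z; lra.
have ty (u : R) : multiple l (u - t) -> multiple l (u - y).
  move=> H; have -> : u - y = (u - t) - z%:~R * l by rewrite /t; ring.
  by apply: multipleB => //; exists z.
have pcoord_in (i : 'I_n.+1) (c : bool) s : (i < k)%N -> 0 < s < len (inl (k, c) : edg G) ->
    pcoord i (edge_point (inl (k, c) : edg G) s) = 0.
  move=> ik Hs; rewrite pcoord_edge_point //; case: c Hs => Hs /=; rewrite pcoord_vtx /=.
    by rewrite loc_chain_v leqNgt ik /= -val_eqE gtn_eqF // mul0r addr0.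
  by rewrite ltnNge (ltnW ik) /= -val_eqE gtn_eqF // mul0r addr0.
have [tb|] := ltP t (l - b).
  move: t0; rewrite le_eqVlt => /orP[/eqP t0|t0].
    exists (inl (chain_w C k)); split=> //=.
      by move=> i ik; rewrite pcoord_vtx_right //= ltnW.
    by apply: ty; rewrite pcoord_vtx_right //= -t0 subrr; apply: multiple0.
  have Ht : 0 < t < len (inl (k, false) : edg G) by rewrite /= t0.
  exists (edge_point (inl (k, false) : edg G) t); split=> //=.
  - by rewrite /loc cell_edge_point.
  - by move=> i ik; apply: pcoord_in.
  - apply: ty; rewrite pcoord_edge_point // pcoord_vtx_right //= eqxx.
    by rewrite add0r mul1r subrr; apply: multiple0.
rewrite le_eqVlt => /orP[/eqP tb|tb].
  exists (inl (chain_v C k)); split=> //=.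
  - by rewrite /loc /= loc_chain_v.
  - by move=> i ik; rewrite pcoord_vtx_right // loc_chain_v.
  - apply: ty; rewrite pcoord_vtx loc_chain_v leqnn -tb -/b.
    by exists (-1); rewrite mulN1r; ring.
have Ht : 0 < t - (l - b) < len (inl (k, true) : edg G) by rewrite /= -/b; apply/andP; split; lra.
exists (edge_point (inl (k, true) : edg G) (t - (l - b))); split=> //=.
- by rewrite /loc cell_edge_point.
- by move=> i ik; apply: pcoord_in.
- apply: ty; rewrite pcoord_edge_point // pcoord_vtx /= loc_chain_v leqnn eqxx.
  by rewrite -/b; exists (-1) => /=; ring.
Qed.

(** Half a turn away from y. *)
Lemma pcoord_avoid k (y : R) : exists p, [/\ (loc p <= k.+1)%N,
  forall i : 'I_n.+1, (i < k)%N -> pcoord i p = 0 & ~ multiple (cycle_len C k) (pcoord k p - y)].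
Proof.
have l0 := cycle_len_gt0 k.
have [p [locp left_p Hp]] := pcoord_surj k (y + cycle_len C k / 2).
exists p; split=> // Hy; have [z] := multipleB Hy Hp.
have -> : pcoord k p - y - (pcoord k p - (y + cycle_len C k / 2)) = 2^-1 * cycle_len C k by ring.
move/(mulIf (lt0r_neq0 l0)) => z2.
have : (z * 2)%:~R = 1%:~R :> R by rewrite rmorphM /= -z2; field.
by move/intr_inj; lia.
Qed.

Lemma effective0 : effective (0 : divisor G).
Proof. by move=> p; rewrite coeff0. Qed.

Lemma effectiveD D E : effective D -> effective E -> effective (D + E).
Proof. by move=> D0 E0 p; rewrite coeffD addr_ge0. Qed.

Lemma effectiveU (m : nat) p : effective (<< m%:Z *g p >> : divisor G).
Proof. by move=> q; rewrite coeffU; case: (p == q); rewrite ?mulr1 ?mulr0. Qed.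

Lemma linext_ge0 (f : point G -> int) E :
  effective E -> (forall p, 0 <= f p) -> 0 <= linext f E.
Proof.
move=> E0 f0; apply: sumr_ge0 => p _; rewrite -mulrzr intz.
by rewrite mulr_ge0.
Qed.

Definition left_supported j D := forall p, (j < loc p)%N -> coeff p D = 0.

Lemma left_supportedD j D E : left_supported j D -> left_supported j E ->
  left_supported j (D + E).
Proof. by move=> HD HE p jp; rewrite coeffD HD ?HE. Qed.

Lemma left_supportedU j m p : (loc p <= j)%N ->
  left_supported j (<< m *g p >> : divisor G).
Proof.
move=> pj q jq; rewrite coeffU; case: eqP => [pq|]; last by rewrite mulr0.
by move: jq; rewrite -pq ltnNge pj.
Qed.

Lemma left_supportedW i j D : (i <= j)%N -> left_supported i D -> left_supported j D.
Proof. by move=> ij H p jp; apply: H; apply: leq_ltn_trans jp. Qed.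

(** No chip lies on the k-th cycle outside v_k, so that only the chips seen at
    v_k count. *)
Lemma coord_left k D : (forall p, loc p = k.+1 -> coeff p D = 0) ->
  coord k D = - (left_deg k D)%:~R * arc C k.
Proof.
move=> H; rewrite /coord /left_deg /linext rmorph_sum -sumrN mulr_suml.
rewrite big_seq [RHS]big_seq; apply: eq_bigr => p; rewrite mem_dom => pD.
rewrite pcoord_far; last by apply: contra pD => /eqP/H ->.
case: leqP => _ /=; last by rewrite mulr0z !mul0rz oppr0 mul0r.
by rewrite mulr1z intz mulNrz mulNr mulrzl.
Qed.

Lemma left_deg_supported j D : left_supported j D -> left_deg j D = deg D.
Proof.
move=> H; rewrite /left_deg deg_linext /linext big_seq [RHS]big_seq.
apply: eq_bigr => p; rewrite mem_dom => pD; case: leqP => // /H pD0.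
by rewrite pD0 in pD.
Qed.

Lemma left_deg_ge0 j E : effective E -> 0 <= left_deg j E.
Proof. by move=> E0; apply: linext_ge0. Qed.

Lemma left_deg_le j E : effective E -> left_deg j E <= left_deg j.+1 E.
Proof.
move=> E0; rewrite -subr_ge0 /left_deg /linext -sumrB; apply: sumr_ge0 => p _.
rewrite -mulrzBl -mulrzr intz mulr_ge0 ?E0 // subr_ge0 lez_nat.
by case: (leqP (loc p) j) => // pj; rewrite (leq_trans pj (leqnSn j)).
Qed.

Lemma left_deg_eq j E : effective E -> left_deg j.+1 E = left_deg j E ->
  forall p, loc p = j.+1 -> coeff p E = 0.
Proof.
move=> E0 eqE p locp; apply/eqP; apply: contraT => pE.
have : left_deg j.+1 E - left_deg j E = 0 by rewrite eqE subrr.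
rewrite /left_deg /linext -sumrB => /eqP; rewrite psumr_eq0.
  move/allP => /(_ p); rewrite mem_dom pE => /(_ isT).
  by rewrite locp leqnn ltnn mul0rz subr0 intz (negbTE pE).
move=> q _; rewrite -mulrzBl -mulrzr intz mulr_ge0 ?E0 // subr_ge0 lez_nat.
by case: (leqP (loc q) j) => // qj; rewrite (leq_trans qj (leqnSn j)).
Qed.

Lemma coordsD D E i : coords (D + E) i = coords D i + coords E i.
Proof. by rewrite /coords /coord raddfD. Qed.

Lemma coordsB D E i : coords (D - E) i = coords D i - coords E i.
Proof. by rewrite /coords /coord raddfB. Qed.

Lemma coordsU m p i : coords (<< m *g p >> : divisor G) i = pcoord (inord i) p *~ m.
Proof. by rewrite /coords /coord linextU. Qed.

Lemma lin_equiv_coords D D' : lin_equiv D D' <->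
  deg D = deg D' /\ agree lens n.+1 (coords D) (coords D').
Proof.
rewrite lin_equivP; split=> -[degD H]; split=> //.
  by move=> i _; apply: H.
by move=> k; have := H k (ltn_ord k); rewrite /coords /lens inord_val.
Qed.

Lemma coords_left j D : (j < n.+1)%N -> (forall p, loc p = j.+1 -> coeff p D = 0) ->
  coords D j = - (left_deg j D)%:~R * arcs j.
Proof.
move=> jn H; rewrite /coords coord_left ?inordK //.
Qed.

Lemma lingers_left x j E : (j < n.+1)%N ->
    (forall p, loc p = j.+1 -> coeff p E = 0) -> forall s : nat, left_deg j E = s ->
  lingers x j s <-> multiple (lens j) (x j - coords E j).
Proof.
move=> jn H s sE; rewrite coords_left // sE mulNr opprK.
by split=> /asboolP.
Qed.

(** If E has exactly the minimal number of chips on the left of cycle j and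
    none on it, then the coordinate x_j is due to the chips on the left, which
    means that the cycle lingers. *)
Lemma min_chips_le_left x j E : effective E -> (j <= n.+1)%N -> agree lens j x (coords E) ->
  (min_chips x j)%:Z <= left_deg j E.
Proof.
move=> E0; elim: j => [|j IH] jn xE; first exact: left_deg_ge0.
have {}IH := IH (ltnW jn) (agreeW (leqnSn j) xE).
have le_n := left_deg_le j E0; rewrite /=.
have [eq_n|ne_n] := eqVneq (left_deg j.+1 E) (left_deg j E); last first.
  by case: lingers => /=; lia.
have [eq_s|ne_s] := eqVneq (left_deg j E) (min_chips x j); last first.
  by case: lingers => /=; lia.
have -> : lingers x j (min_chips x j).
  by apply/(lingers_left _ jn (left_deg_eq E0 eq_n) eq_s); apply: xE.
by lia.
Qed.

(** One chip is placed on each cycle that does not linger. *)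
Lemma realize_coords x j : (j <= n.+1)%N -> exists E, [/\ effective E,
  deg E = min_chips x j, left_supported j E & agree lens j x (coords E)].
Proof.
elim: j => [|j IH] jn.
  by exists 0; split=> //; [exact: effective0|rewrite deg0|move=> p _; rewrite coeff0].
have [E [E0 degE leftE xE]] := IH (ltnW jn).
have sE : left_deg j E = min_chips x j by rewrite left_deg_supported.
have far p : loc p = j.+1 -> coeff p E = 0 by move=> pj; apply: leftE; rewrite pj.
rewrite /=; have := lingers_left x jn far sE.
case: (boolP (lingers _ _ _)) => [ling [/(_ isT) xj _]|_ _].
  exists E; split=> //; first by rewrite addn0.
    exact: left_supportedW leftE.
  by move=> i; rewrite ltnS leq_eqVlt => /orP[/eqP->|/xE].
have [p [locp left_p xp]] := pcoord_surj (inord j) (x j - coords E j).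
move: locp left_p; rewrite inordK // => locp left_p.
exists (E + << 1 *g p >>); split.
- by apply: effectiveD => //; apply: (effectiveU 1).
- by rewrite degD degU degE addn1; lia.
- by apply: left_supportedD; [apply: left_supportedW leftE|apply: left_supportedU].
move=> i; rewrite coordsD coordsU mulr1z ltnS leq_eqVlt => /orP[/eqP->|ij].
  by rewrite -[_ - _]opprK; apply: multipleN; congr multiple: xp; ring.
by rewrite left_p ?inordK ?addr0; [apply: xE| |exact: ltn_trans jn].
Qed.

(** All coordinates of the marked point are 0, so the remaining chips may be
    placed there. *)
Lemma effective_equivP D :
  (exists2 E, effective E & lin_equiv D E) <-> (min_chips (coords D) n.+1)%:Z <= deg D.
Proof.
split=> [[E E0 /lin_equiv_coords[-> DE]]|le_s].
  by rewrite -(@left_deg_deg _ _ _ n.+1) //; apply: min_chips_le_left.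
have [E [E0 degE _ DE]] := realize_coords (coords D) (leqnn n.+1).
have [m mE] : exists m : nat, deg D - deg E = m.
  by exists `|deg D - deg E|%N; rewrite gez0_abs // degE subr_ge0.
exists (E + << m%:Z *g chain_mark C >>).
  by apply: effectiveD => //; apply: effectiveU.
apply/lin_equiv_coords; split; first by rewrite degD degU -mE addrC subrK.
move=> i iN; rewrite coordsD coordsU pcoord_vtx_right /= ?inordK //.
by rewrite mul0rz addr0; apply: DE.
Qed.

(** Removing m chips on the left of cycle j has the same effect on it as m
    additional chips there. *)
Lemma lingers_shift x j E (m s : nat) : (j < n.+1)%N ->
    (forall p, loc p = j.+1 -> coeff p E = 0) -> left_deg j E = m ->
  lingers (fun i => x i - coords E i) j s = lingers x j (m + s).
Proof.
move=> jn H mE; rewrite /lingers; congr (`[< multiple _ _ >]).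
by rewrite coords_left // mE natrD; ring.
Qed.

(** The number of lingering cycles is at least the length of row m, where m
    counts the chips of E on the left.  If E has a chip on cycle j, the number m
    increases to some m' and row m' never exceeds the former row m.  Otherwise
    row m grows only if cycle j lingers, unless the inequality was strict. *)
Lemma min_chips_rows_le x j E (m : nat) : effective E -> (j <= n.+1)%N ->
  left_deg j E = m -> (min_chips (fun i => (x i - coords E i)%R) j + rows x j m <= j)%N.
Proof.
move=> E0; set y := fun i => _ : R; elim: j m => [|j IH] m' jn m'E //.
have [m mE] : exists m : nat, left_deg j E = m.
  by exists `|left_deg j E|%N; rewrite gez0_abs // left_deg_ge0.
have {}IH := IH m (ltnW jn) mE; have := left_deg_le j E0.
rewrite mE m'E lez_nat leq_eqVlt => /orP[/eqP mm'|mm'].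
  have eqE : left_deg j.+1 E = left_deg j E by rewrite m'E mE mm'.
  have far := left_deg_eq E0 eqE; rewrite -mm' /= /y (lingers_shift _ _ jn far mE) -/y.
  have := IH; rewrite leq_eqVlt => /orP[/eqP eq_j|lt_j]; last first.
    by case: (lingers _ _ _); case: (_ && _) => /=; lia.
  have -> : (m + j - rows x j m = m + min_chips y j)%N by lia.
  by case: (_ || _); case: (lingers _ _ _) => /=; lia.
have le1 := rows_noninc_le arcs lens x j (ltnW mm').
have le2 : (rows x j m'.-1 <= rows x j m)%N by apply: rows_noninc_le; lia.
rewrite /=; have -> : (m' == 0%N) = false by lia.
have b1 := leq_b1 (~~ lingers y j (min_chips y j)).
case: ltnP => /= lt; last by rewrite addn0; lia.
by have b2 := leq_b1 (lingers x j (m' + j - rows x j m')); lia.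
Qed.

(** The previous bound is attained.  The only case where E has to be changed is
    that of a cycle that lingers while row r has the length of row r - 1, and
    cannot grow: then a worst divisor of degree r - 1 is completed by a chip on
    the cycle, in a position that prevents it from lingering.  For j = 0 the r
    chips are placed at v_0, on the left of all cycles. *)
Lemma worst_divisor x j r : (j <= n.+1)%N -> exists E,
  [/\ effective E, deg E = r, left_supported j E &
      (j <= min_chips (fun i => (x i - coords E i)%R) j + rows x j r)%N].
Proof.
elim: j r => [|j IH] r jn.
  exists << r%:Z *g (inl (inr None) : point G) >>; split=> //.
  - exact: effectiveU.
  - by rewrite degU.
  - exact: left_supportedU.
have [E [E0 degE leftE le_j]] := IH r (ltnW jn).
have rE : left_deg j E = r by rewrite left_deg_supported.
have far p : loc p = j.+1 -> coeff p E = 0 by move=> pj; apply: leftE; rewrite pj.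
have le_j' := min_chips_rows_le x E0 (ltnW jn) rE.
set y := fun i => _ in le_j le_j'.
have ling : lingers y j (min_chips y j) = lingers x j (r + j - rows x j r).
  by rewrite /y (lingers_shift _ _ jn far rE) -/y; congr lingers; lia.
have [stay|] := boolP (((r == 0) || (rows x j r < rows x j r.-1)) ||
                       ~~ lingers y j (min_chips y j))%N.
  exists E; split=> //; first exact: left_supportedW leftE.
  rewrite -/y /= -ling.
  move: stay; case: (lingers _ _ _) => /=; rewrite ?orbF ?orbT ?andbT ?andbF.
    by move=> -> /=; lia.
  by move=> _ /=; lia.
rewrite !negb_or -leqNgt => /andP[/andP[r0 le_r] _].
have [E' [E'0 degE' leftE' le_E']] := IH r.-1 (ltnW jn).
set y' := fun i => _ in le_E'.
have [p [locp left_p p_avoid]] := pcoord_avoid (inord j) (y' j + (min_chips y' j)%:R * arcs j).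
move: locp left_p; rewrite inordK // => locp left_p.
exists (E' + << 1 *g p >>); split.
- by apply: effectiveD => //; apply: (effectiveU 1).
- by rewrite degD degU degE'; lia.
- by apply: left_supportedD; [apply: left_supportedW leftE'|apply: left_supportedU].
rewrite /=; set z := fun i => _.
have zy' : agree lens j z y'.
  move=> i ij; rewrite /z /y' coordsD coordsU mulr1z left_p ?inordK //;
    last exact: ltn_trans jn.
  by rewrite addr0 subrr; apply: multiple0.
have -> : min_chips z j = min_chips y' j by apply: min_chips_agree.
have -> : lingers z j (min_chips y' j) = false.
  apply/asboolP => H; apply: p_avoid; rewrite -[_ - _]opprK; apply: multipleN.
  by congr multiple: H; rewrite /z /y' coordsD coordsU mulr1z; ring.
by case: (_ && _) => /=; lia.
Qed.

Lemma rank_ge_nat D r : rank_ge D r%:Z <->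
  (r + n.+1)%:Z <= deg D + (rows (coords D) n.+1 r)%:Z.
Proof.
have eq_y E : (fun i => coords D i - coords E i) = coords (D - E).
  by apply: funext => i; rewrite coordsB.
split=> [rankD|le_r E E0 degE].
  have [E [E0 degE leftE le_n]] := worst_divisor (coords D) r (leqnn n.+1).
  have /effective_equivP := rankD E E0 degE.
  by rewrite degB degE -eq_y; lia.
apply/effective_equivP; rewrite degB degE -eq_y.
have rE : left_deg n.+1 E = r by rewrite left_deg_deg.
by have := min_chips_rows_le (coords D) E0 (leqnn _) rE; lia.
Qed.

Lemma effective_deg E : effective E -> 0 <= deg E.
Proof. by move=> E0; rewrite deg_linext; apply: linext_ge0. Qed.

Lemma rank_ge_neg D (r : int) : r < 0 -> rank_ge D r.
Proof. by move=> r0 E /effective_deg E0 degE; rewrite degE leNgt r0 in E0. Qed.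

(** The rank is bounded by the degree because no row has more than n.+1 boxes,
    so that the maximum in its definition exists. *)
Lemma rank_max D : rank_ge D (rank D) /\ forall s : int, rank_ge D s -> s <= rank D.
Proof.
suff [m Hm] : exists m : int, rank_ge D m /\ forall s : int, rank_ge D s -> s <= m.
  exact: (@xgetPex _ (-1) [set m : int | rank_ge D m /\
    forall s : int, rank_ge D s -> s <= m]%classic) (ex_intro _ m Hm).
have bound (r : nat) : `[< rank_ge D r%:Z >] -> (r <= `|deg D|)%N.
  move=> /asboolP/rank_ge_nat; have := rows_le arcs lens (coords D) n.+1 r; lia.
have [ex0|no] := pselect (exists r : nat, `[< rank_ge D r%:Z >]).
  have [m /asboolP Hm max_m] := ex_maxnP ex0 bound.
  exists m%:Z; split=> // -[r|r] Hr; last by lia.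
  by rewrite lez_nat; apply: max_m; apply/asboolP.
exists (-1); split=> [|[r|r] Hr]; first exact: rank_ge_neg.
  by case: no; exists r; apply/asboolP.
by lia.
Qed.

Lemma le_rank D r : r%:Z <= rank D <->
  (r + n.+1)%:Z <= deg D + (rows (coords D) n.+1 r)%:Z.
Proof.
have [rankD maxD] := rank_max D; split=> [|/rank_ge_nat/maxD //].
case: (rank D) rankD => [m|//] /rank_ge_nat le_m; rewrite lez_nat => rm.
by have := rows_noninc_le arcs lens (coords D) n.+1 rm; lia.
Qed.

End Rank.

(** * Torsion orders *)

Section Torsion.
Context {R : realType}.

Lemma torsion_le (b l : R) (d : nat) : (0 < d)%N -> multiple l (d%:R * b) ->
  (0 < torsion_order b l <= d)%N.
Proof.
move=> d0 [z Hz]; rewrite /torsion_order; case: pselect => [rat_b|]; last first.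
  case; exists (z%:~R / d%:R); rewrite fmorph_div /= ratr_int ratr_nat mulrAC -Hz.
  by rewrite mulrAC mulfV ?mul1r // pnatr_eq0 -lt0n.
case: ex_minnP => m /andP[m0 _] min_m; rewrite m0 min_m // d0.
by apply/asboolP; exists z.
Qed.

Lemma torsion_multiple (b l : R) : multiple l ((torsion_order b l)%:R * b).
Proof.
rewrite /torsion_order; case: pselect => [rat_b|_]; last by rewrite mul0r; apply: multiple0.
by case: ex_minnP => m /andP[_ /asboolP].
Qed.

End Torsion.

(** * The loci W^lam *)

Section SpecialDivisors.
Context {R : realType} {n : nat} (C : chain_of_cycles R n).
Local Notation G := (chain_graph C).
Implicit Types (D E : divisor G) (lam : seq nat).
Local Notation rows := (rows (arcs C) (lens C)).

Lemma mem_boxes lam (u v : int) : reflect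
  (exists i j : nat, [/\ (0 < i <= nth 0%N lam j)%N, u = i%:Z & v = j.+1%:Z])
  ((u, v) \in boxes lam).
Proof.
apply: (iffP allpairsPdep) => [[j [i [_ i_in [-> ->]]]]|[i [j [/andP[i0 i_le] -> ->]]]].
  by exists i, j; split=> //; move: i_in; rewrite mem_iota add1n ltnS.
exists j, i; split=> //; last by rewrite mem_iota add1n ltnS i0.
rewrite mem_iota add0n /= ltnNge; apply: contraL i0 => sj.
by rewrite nth_default // leqn0 in i_le; rewrite (eqP i_le).
Qed.

Lemma size_boxes lam : size (boxes lam) = sumn lam.
Proof.
rewrite size_allpairs_dep; congr sumn.
under eq_map do rewrite size_iota.
exact: mkseq_nth.
Qed.

Lemma sumn_big lam : sumn lam = (\sum_(r < size lam) nth 0 lam r)%N.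
Proof. by rewrite sumnE (big_nth 0%N) big_mkord. Qed.

(** Chips at the marked point do not change the coordinates, only the degree.
    For given r, the box at the end of row r gives the strongest condition. *)
Lemma le_rank_mark D lam : deg D = 0 ->
  (forall d r : int, ((genus G)%:Z - d + r, r + 1) \in boxes lam ->
     r <= rank (D + << d *g chain_mark C >>)) <->
  (forall r, (nth 0 lam r <= rows (coords D) n.+1 r)%N).
Proof.
move=> degD0.
have degd d : deg (D + << d *g chain_mark C >>) = d by rewrite degD degU degD0 add0r.
have rowsd d r : rows (coords (D + << d *g chain_mark C >>)) n.+1 r = rows (coords D) n.+1 r.
  apply: rows_agree => i iN; rewrite coordsD coordsU pcoord_vtx_right /= ?inordK //.
  by rewrite mul0rz addr0 subrr; apply: multiple0.
rewrite genus_chain; split=> [H r|H d r /mem_boxes[i [j [/andP[i0 i_le] di rj]]]].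
  case: (posnP (nth 0 lam r)%N) => [->//|lam0].
  have /H/le_rank : (n.+1%:Z - (n.+1%:Z + r%:Z - (nth 0%N lam r)%:Z) + r%:Z, r%:Z + 1)
                     \in boxes lam.
    by apply/mem_boxes; exists (nth 0%N lam r), r; split; [rewrite lam0 leqnn|lia|lia].
  by rewrite degd rowsd; lia.
have -> : r = j%:Z by lia.
by apply/le_rank; rewrite degd rowsd; have := H j; lia.
Qed.

Lemma W_class D lam : W (chain_mark C) lam (divisor_class D) <->
  deg D = 0 /\ forall r, (nth 0 lam r <= rows (coords D) n.+1 r)%N.
Proof.
split=> [[D0 [deg0 H] eqD]|[degD H]]; last first.
  by exists D => //; split=> //; apply/le_rank_mark.
have : divisor_class D0 D0.
  by apply/lin_equiv_coords; split=> // i _; rewrite subrr; apply: multiple0.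
rewrite eqD => /lin_equiv_coords[degD DD0]; split; first by rewrite degD.
move=> r; rewrite (rows_agree _ DD0).
by move: r; apply/le_rank_mark.
Qed.

End SpecialDivisors.

(** * Generic values of polynomials modulo lattices *)

Section GenericParameter.
Context {R : realType}.

(** One of the numbers delta / (m + 1) is not a root. *)
Lemma avoid_roots (q : {poly R}) (delta : R) : q != 0 -> 0 < delta ->
  exists2 s : R, 0 < s <= delta & ~~ root q s.
Proof.
move=> q0 d0; pose f (m : nat) : R := delta / m.+1%:R.
apply: contrapT => no.
have f_root m : root q (f m).
  apply: contraT => nr; case: no; exists (f m) => //.
  by rewrite divr_gt0 //= ler_pdivrMr // ler_peMr ?(ltW d0) ?ler1n.
have f_inj : injective f.
  move=> m m' /(mulfI (lt0r_neq0 d0))/invr_inj/eqP.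
  by rewrite eqr_nat eqSS => /eqP.
have := @max_poly_roots _ q (mkseq f (size q)) q0.
rewrite map_inj_uniq ?iota_uniq // size_mkseq ltnn => H.
suff : false by []; apply: H => //.
by apply/allP => _ /mapP[m _ ->].
Qed.

Lemma horner_le (p : {poly R}) (s : R) : 0 <= s <= 1 ->
  `|p.[s]| <= \sum_(i < size p) `|p`_i|.
Proof.
move=> /andP[s0 s1]; rewrite horner_coef; apply: le_trans (ler_norm_sum _ _ _) _.
apply: ler_sum => i _; rewrite normrM ler_piMr ?normr_ge0 // ger0_norm ?exprn_ge0 //.
exact: exprn_ile1.
Qed.

(** As p is bounded on [0, 1], finitely many multiples of l are involved. *)
Lemma multiple_root (p : {poly R}) (l u : R) : 0 < l -> (1 < size p)%N ->
  exists2 q : {poly R}, q != 0 & forall s, 0 <= s <= 1 -> multiple l (p.[s] + u) -> root q s.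
Proof.
move=> l0 p1; pose B := (\sum_(i < size p) `|p`_i| + `|u|) / l.
pose Z := Num.truncn B.
have B0 : 0 <= B.
  by rewrite divr_ge0 ?(ltW l0) // addr_ge0 ?normr_ge0 ?sumr_ge0 // => i _.
exists (\prod_(m < (2 * Z).+1) (p + (u - (m%:Z - Z%:Z)%:~R * l)%:P)).
  apply/prodf_neq0 => m _; rewrite -size_poly_gt0 size_polyDl ?(ltnW p1) //.
  by apply: leq_ltn_trans p1; apply: size_polyC_leq1.
move=> s s01 [z Hz]; have le_z : `|z|%:~R <= B.
  rewrite intr_norm ler_pdivlMr // -[X in _ * X]gtr0_norm // -normrM -Hz.
  by apply: le_trans (ler_normD _ _) _; rewrite lerD2r horner_le.
have zZ : `|z| <= Z%:Z.
  have := truncn_itv B0; rewrite -/Z => /andP[_ BZ].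
  have : (`|z|%:~R : R) < Z.+1%:R by apply: le_lt_trans le_z BZ.
  by rewrite pmulrn ltr_int; lia.
have lt_m : (absz (z + Z%:Z)%R < (2 * Z).+1)%N by lia.
rewrite /root horner_prod (bigD1 (Ordinal lt_m)) //= mulf_eq0; apply/orP; left.
rewrite hornerD hornerC addrA Hz gez0_abs; last by lia.
by rewrite addrK subrr.
Qed.

Lemma generic_parameter (I : finType) (p : I -> {poly R}) (l u : I -> R) (delta : R) :
    0 < delta <= 1 -> (forall i, 0 < l i) ->
  exists2 s : R, 0 < s <= delta &
    forall i, (1 < size (p i))%N -> ~ multiple (l i) ((p i).[s] + u i).
Proof.
move=> /andP[d0 d1] l0.
have /boolp.choice[q Hq] i : exists q : {poly R}, q != 0 /\
    forall s, 0 <= s <= 1 -> (1 < size (p i))%N -> multiple (l i) ((p i).[s] + u i) -> root q s.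
  have [p1|p1] := boolP (1 < size (p i))%N.
    by have [q q0 Hq] := multiple_root (u i) (l0 i) p1; exists q; split=> // s s01 _; apply: Hq.
  by exists 1; split; rewrite ?oner_neq0.
have [|s /andP[s0 sd] nr] := @avoid_roots (\prod_i q i) delta _ d0.
  by apply/prodf_neq0 => i _; case: (Hq i).
exists s; first by rewrite s0.
move=> i p1 Hi; case/negP: nr; rewrite /root horner_prod (bigD1 i) //=.
have [_ /(_ s) qi] := Hq i.
have /rootP -> : root (q i) s by apply: qi => //; rewrite ltW //= (le_trans sd).
by rewrite mul0r.
Qed.

End GenericParameter.

(** * Cells in the loci W^lam *)

Section Cells.
Context {R : realType} {n : nat} (C : chain_of_cycles R n).
Local Notation G := (chain_graph C).
Implicit Types (D E : divisor G) (lam : seq nat) (i : 'I_n.+1).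
Local Notation rows := (rows (arcs C) (lens C)).
Local Notation special := (special (arcs C) (lens C)).

Definition cycle_sum (s : edg G -> R) i : R :=
  s (inl (i, true) : edg G) + s (inl (i, false) : edg G).

(** The coordinate of the divisor of all sources, which corresponds to the
    displacement 0. *)
Definition origin i : R := \sum_(e : edg G) pcoord i (inl (src e)).

Lemma pcoord_edge_point_closed i (e : edg G) (t : R) : 0 <= t <= len e ->
  multiple (cycle_len C i)
    (pcoord i (edge_point e t) - (pcoord i (inl (src e)) + on_cycle i e * t)).
Proof.
case/andP; rewrite le_eqVlt => /orP[/eqP <- _|t0].
  by rewrite edge_point0 mulr0 addr0 subrr; apply: multiple0.
rewrite le_eqVlt => /orP[/eqP ->|tL]; first by rewrite edge_point_len; apply: pcoord_tgt.
by rewrite pcoord_edge_point ?t0 // subrr; apply: multiple0.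
Qed.

(** A displacement along an edge of the i-th cycle is a displacement of the
    i-th coordinate, and leaves the other coordinates unchanged. *)
Lemma coord_cell D (s : edg G -> R) i : (forall e, 0 <= s e <= len e) ->
  multiple (cycle_len C i) (coord i (D + \sum_e << edge_point e (s e) >>) -
                      (coord i D + origin i + cycle_sum s i)).
Proof.
move=> Hs; rewrite /coord raddfD raddf_sum /=.
under eq_bigr do rewrite linextU mulr1z.
have -> : cycle_sum s i = \sum_(e : edg G) on_cycle i e * s e.
  rewrite sum_chain_edg /= [X in _ + X]big1 ?addr0 => [|j _]; last by rewrite mul0r.
  rewrite (bigD1 i) //= eqxx !mul1r big1 ?addr0 // => k /negbTE ->.
  by rewrite !mul0r addr0.
have shift (u v w z : R) : u + v - (u + w + z) = v - (w + z) by ring.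
rewrite shift /origin -big_split -sumrB.
by apply: multiple_sum => e _; apply: pcoord_edge_point_closed.
Qed.

Lemma realize_class (y : 'I_n.+1 -> R) (d : int) : exists D,
  deg D = d /\ forall i, multiple (cycle_len C i) (coord i D - y i).
Proof.
have [E [_ degE _ yE]] := realize_coords C (fun m => y (inord m)) (leqnn n.+1).
exists (E + << d - deg E *g chain_mark C >>).
split; first by rewrite degD degU addrC subrK.
move=> i; rewrite /coord raddfD /= linextU pcoord_vtx_right //= mul0rz addr0.
have := yE i (ltn_ord i); rewrite /coords /lens inord_val -/(coord i E) => /multipleN.
by rewrite opprB.
Qed.

Lemma deg_cell D (s : edg G -> R) :
  deg (D + \sum_e << edge_point e (s e) >>) = deg D + #|edg G|%:Z.
Proof.
rewrite degD raddf_sum /=; congr (_ + _).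
by under eq_bigr do rewrite degU; rewrite sumr_const natz.
Qed.

(** The j-th vertex of the cell is obtained from the 0-th one by moving a chip
    from v_i to w_i, where i is the j-th element of J. *)
Lemma free_cell (J : {set 'I_n.+1}) (y : nat -> R) lam :
    (forall x : nat -> R, (forall i, i \notin J -> multiple (cycle_len C i) (x i - y i)) ->
       forall r, (nth 0%N lam r <= rows x n.+1 r)%N) ->
  contains_cell (W (chain_mark C) lam) #|J|.
Proof.
move=> HJ; have [D [D_deg yD]] := realize_class (fun i => y i - origin i) (- #|edg G|%:Z).
pose a (j : 'I_#|J|.+1) (e : edg G) : R :=
  if unlift ord0 j is Some j' then
    match (e : chain_edg C) with
    | inl (i, true) => if i == enum_val j' then arc C i else 0
    | _ => 0
    end
  else 0.
have a0 e : a ord0 e = 0 by rewrite /a unlift_none.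
have aS j e : a (lift ord0 j) e = match (e : chain_edg C) with
    | inl (i, true) => if i == enum_val j then arc C i else 0
    | _ => 0
    end by rewrite /a liftK.
have a_itv j e : 0 <= a j e <= len e.
  rewrite /a; case: unliftP => [j'|] _; last by rewrite lexx ltW ?len_gt0.
  case: e => [[i []]|b]; rewrite ?lexx ?(ltW (len_gt0 _)) //=.
  have /andP[i0 _] := arc_itv C i.
  by case: ifP => _; rewrite ?lexx ltW.
exists D, a; split=> // [c [h Hh] j|t t0 t1].
  have := Hh (inl (enum_val j, true)); have := Hh (inl (enum_val j, false)).
  rewrite /= big1 => [|j' _]; last by rewrite aS a0 subrr mulr0.
  rewrite (bigD1 j) //= big1 ?addr0 => [|j' j'j]; last first.
    rewrite aS a0 subr0 ifN ?mulr0 //; apply: contra j'j => /eqP/enum_val_inj ->.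
    exact: eqxx.
  rewrite aS a0 subr0 eqxx => /esym/eqP; rewrite subr_eq0 => /eqP ->.
  rewrite subrr => /eqP; rewrite mulf_eq0 => /orP[/eqP //|].
  by have /andP[/lt0r_neq0/negbTE ->] := arc_itv C (enum_val j).
set s := fun e => \sum_j t j * a j e.
have Hs e : 0 <= s e <= len e.
  apply/andP; split; first by apply: sumr_ge0 => j _; have /andP[? _] := a_itv j e; apply: mulr_ge0.
  rewrite -[leRHS]mul1r -t1 mulr_suml; apply: ler_sum => j _.
  by apply: ler_wpM2l => //; have /andP[] := a_itv j e.
apply/W_class; split; first by rewrite deg_cell D_deg addNr.
apply: HJ => i iJ; rewrite /coords inord_val.
have s0 : cycle_sum s i = 0.
  rewrite /cycle_sum /s !big1 ?addr0 // => j _; rewrite /a; case: unliftP => [j'|] _;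
    rewrite ?mulr0 // ifN ?mulr0 //.
  by apply: contra iJ => /eqP ->; apply: enum_valP.
have := multipleD (coord_cell D i Hs) (yD i); rewrite s0; congr multiple; ring.
Qed.

(** On the curve of barycentric coordinates t_(j+1) = s^(j+1) in the simplex,
    the coordinates are polynomials in s.  For generic s those that are not
    constant avoid the special values, so at least |lam| coordinates are
    constant on the cell.  The other ones determine the point of the cell, which
    bounds its dimension k. *)
Lemma cell_le (k : nat) lam :
    (forall x : nat -> R, (forall r, (nth 0%N lam r <= rows x n.+1 r)%N) ->
       (sumn lam <= \sum_(i < n.+1) special x i)%N) ->
  contains_cell (W (chain_mark C) lam) k -> (k + sumn lam <= n.+1)%N.
Proof.
move=> Hspecial [D [a [a_itv indep inW]]].
(* The linear part of the map from the cell to the coordinates. *)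
pose M : 'M[R]_(k, n.+1) := \matrix_(j, i)
   cycle_sum (fun e => a (lift ord0 j) e - a ord0 e) i.
have freeM : row_free M.
  rewrite -kermx_eq0; apply/rowV0P => c /sub_kermxP cM.
  apply/rowP => j; rewrite mxE; apply: (indep (fun j => c 0 j)); apply: exact_chain => i.
  have /matrixP/(_ 0 i) := cM; rewrite !mxE => cMi.
  apply: etrans cMi; rewrite -big_split /=.
  by apply: eq_bigr => j' _; rewrite mxE /cycle_sum -mulrDr.
(* The coordinates that are not constant on the cell. *)
pose J := [set i | [exists j, M j i != 0]].
have rankM : (k <= #|J|)%N.
  rewrite -(eqP freeM).
  have -> : M = colsub (fun m : 'I_#|J| => enum_val m) M *m
      (\matrix_(m < #|J|, i < n.+1) (enum_val m == i)%:R).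
    apply/matrixP => j i; rewrite !mxE.
    have [iJ|iJ] := boolP (i \in J).
      rewrite (bigD1 (enum_rank_in iJ i)) //= !mxE enum_rankK_in // eqxx mulr1.
      rewrite big1 ?addr0 // => m ne; rewrite !mxE; case: eqP => [mi|]; last by rewrite mulr0.
      by case/eqP: ne; apply: enum_val_inj; rewrite enum_rankK_in.
    rewrite big1 => [|m _]; last first.
      rewrite !mxE; case: eqP => [mi|]; last by rewrite mulr0.
      by rewrite -mi enum_valP in iJ.
    by move: iJ; rewrite inE => /existsPn/(_ j); rewrite negbK => /eqP; rewrite mxE.
  exact: mulmx_max_rank.
pose p i : {poly R} := \sum_(j < k) M j i *: 'X^(j.+1).
have p_size i : i \in J -> (1 < size (p i))%N.
  rewrite inE => /existsP[j Mj]; rewrite ltnNge; apply: contra Mj => sp.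
  have : (p i)`_j.+1 = 0 by rewrite nth_default // (leq_trans sp).
  rewrite coef_sum (bigD1 j) //= coefZ coefXn eqxx mulr1 big1 ?addr0 => [->//|j' j'j].
  by rewrite coefZ coefXn eqSS eq_sym val_eqE (negbTE j'j) mulr0.
pose base i := coord i D + origin i + cycle_sum (a ord0) i.
pose I : finType := ('I_n.+1 * 'I_(2 * n).+1)%type.
have delta : 0 < (k.+1%:R : R)^-1 <= 1.
  by rewrite invr_gt0 ltr0n /= invf_le1 ?ltr0n // ler1n.
have [|s /andP[s0 sk] generic] := @generic_parameter R I (fun it => p it.1)
  (fun it => cycle_len C it.1) (fun it => base it.1 + it.2%:R * arc C it.1) _ delta.
  by move=> it; apply: cycle_len_gt0.
have s1 : s <= 1 by apply: le_trans sk _; case/andP: delta.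
pose t (j : 'I_k.+1) : R := if unlift ord0 j is Some j' then s ^+ j'.+1
                            else 1 - \sum_(j' < k) s ^+ j'.+1.
have t0E : t ord0 = 1 - \sum_(j' < k) s ^+ j'.+1 by rewrite /t unlift_none.
have tSE j : t (lift ord0 j) = s ^+ j.+1 by rewrite /t liftK.
have t_ge0 j : 0 <= t j.
  rewrite /t; case: unlift => [j'|]; first by rewrite exprn_ge0 // ltW.
  rewrite subr_ge0; apply: (@le_trans _ _ (\sum_(j' < k) k.+1%:R^-1)).
    apply: ler_sum => j' _; apply: le_trans sk.
    by rewrite exprS ler_piMr ?exprn_ile1 // ltW.
  rewrite sumr_const card_ord -[_ *+ k]mulr_natl ler_pdivrMr ?ltr0n // mul1r ler_nat.
  exact: leqnSn.
have t_sum : \sum_j t j = 1.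
  rewrite big_ord_recl t0E.
  by rewrite [X in _ + X](eq_bigr (fun j : 'I_k => s ^+ j.+1)) ?subrK.
have /W_class[_ /Hspecial] := inW t t_ge0 t_sum.
set D1 := D + _; pose x i := coord i D1.
have xE i : multiple (cycle_len C i) (x i - ((p i).[s] + base i)).
  set sig := fun e => \sum_j t j * a j e.
  have Hsig e : 0 <= sig e <= len e.
    apply/andP; split; first by apply: sumr_ge0 => j _; have /andP[? _] := a_itv j e; apply: mulr_ge0.
    rewrite -[leRHS]mul1r -t_sum mulr_suml; apply: ler_sum => j _.
    by apply: ler_wpM2l => //; have /andP[] := a_itv j e.
  have := coord_cell D i Hsig; congr multiple; rewrite -/D1 -/(x i); congr (_ - _).
  rewrite /base [RHS]addrC -!addrA; congr (_ + (_ + _)).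
  have sigE e : sig e = a ord0 e + \sum_(j < k) s ^+ j.+1 * (a (lift ord0 j) e - a ord0 e).
    rewrite /sig big_ord_recl t0E mulrBl mul1r -addrA; congr (_ + _).
    rewrite mulr_suml -sumrN -big_split /=; apply: eq_bigr => j _.
    by rewrite tSE; ring.
  rewrite /cycle_sum !sigE addrACA [RHS]addrA; congr (_ + _).
  rewrite -big_split /= horner_sum; apply: eq_bigr => j _.
  by rewrite hornerZ hornerXn mxE /cycle_sum; ring.
move=> le_special; apply: leq_trans (leq_add rankM le_special) _.
have : (\sum_(i < n.+1) special (coords D1) i <= #|~: J|)%N; last first.
  by rewrite -(leq_add2l #|J|) cardsC card_ord.
rewrite -sum1_card [leqRHS]big_mkcond; apply: leq_sum => i _.
rewrite inE; case: (boolP (i \in J)) => /= [iJ|_]; last exact: leq_b1.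
rewrite leqn0 eqb0; apply/existsP => -[[m m_lt] /asboolP /= Hm].
have m_lt' : (m < (2 * n).+1)%N.
  by apply: leq_trans m_lt _; rewrite ltnS leq_mul2l -ltnS ltn_ord.
apply: (generic (i, Ordinal m_lt')); first exact: p_size.
move: Hm; rewrite /coords /lens /arcs inord_val => Hm /=.
have := multipleB Hm (xE i); congr multiple; rewrite /x; ring.
Qed.

End Cells.

(** * The two implications *)

Lemma card_ord_itv (N a b : nat) : (b <= N)%N ->
  #|[set i : 'I_N | (a <= i < b)%N]| = (b - a)%N.
Proof.
move=> bN; rewrite -sum1dep_card -(big_mkord (fun i => a <= i < b)%N (fun=> 1%N)).
rewrite -[RHS]muln1 -(sum_nat_const_nat a b 1) (big_nat_widen _ _ _ _ _ bN).
by rewrite [RHS](big_nat_widenl a 0%N) //; apply: eq_bigl => i; rewrite andbC.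
Qed.

Section Main.
Context {R : realType} {n : nat} (C : chain_of_cycles R n).
Local Notation rows := (rows (arcs C) (lens C)).
Local Notation special := (special (arcs C) (lens C)).

Definition large_torsion :=
  forall i : 'I_n.+1, (0 < i)%N -> torsion C i = 0%N \/ (i.+1 < torsion C i)%N.

(** The cell of dimension g - |lam| is obtained by fixing the first |lam|
    coordinates. *)
Lemma large_torsion_general : large_torsion -> Brill_Noether_general (chain_mark C).
Proof.
move=> tors; have large j d : (0 < j < n.+1)%N -> (0 < d <= j.+1)%N ->
    ~ multiple (lens C j) (d%:R * arcs C j).
  move=> /andP[j0 jn] /andP[d0 dj] /(torsion_le d0); rewrite -/(torsion C (inord j)).
  by have := tors (inord j); rewrite inordK // => /(_ j0); lia.
have Hspecial lam (x : nat -> R) : (forall r, (nth 0%N lam r <= rows x n.+1 r)%N) ->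
    (sumn lam <= \sum_(i < n.+1) special x i)%N.
  move=> le_rows; apply: leq_trans (sum_rows_le large x (size lam) (leqnn n.+1)).
  by rewrite sumn_big; apply: leq_sum => r _; apply: le_rows.
move=> lam part_lam; rewrite genus_chain size_boxes; split=> [le_g|gt_g].
  split=> [|k /(cell_le (Hspecial lam)) le_k]; last by rewrite leq_subRL // addnC.
  have [y Hy] := fill_partition (arcs C) (lens C) part_lam.
  pose J := ~: [set i : 'I_n.+1 | (0 <= i < sumn lam)%N].
  have -> : (n.+1 - sumn lam)%N = #|J|.
    by rewrite cardsCs finset.setCK card_ord card_ord_itv // subn0.
  apply: (free_cell (y := y)) => x Hx r.
  apply: leq_trans (rows_le_mono _ _ _ _ le_g); apply: Hy => j j_lt.
  have jn : (j < n.+1)%N by apply: leq_trans le_g.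
  by have := Hx (inord j); rewrite !inE inordK // j_lt; exact.
apply/seteqP; split=> // S WS; have [D DW SD] := WS.
move: WS; rewrite -SD => /W_class[_ /Hspecial le_lam].
suff : (sumn lam <= n.+1)%N by rewrite leqNgt gt_g.
apply: leq_trans le_lam _; rewrite -[leqRHS]card_ord -sum1_card.
by apply: leq_sum => i _; apply: leq_b1.
Qed.

(** If 0 < m <= i + 1 for the torsion order m of cycle i, fixing m coordinates
    gives a cell of dimension g - m, for a partition with m + 1 boxes. *)
Lemma general_large_torsion : Brill_Noether_general (chain_mark C) -> large_torsion.
Proof.
move=> general i i0; case: (posnP (torsion C i)) => [|tors0]; first by left.
right; rewrite ltnNge; apply/negP => tors_le; pose m := torsion C i.
have tors_multiple : multiple (lens C i) (m%:R * arcs C i).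
  by rewrite /lens /arcs inord_val; apply: torsion_multiple.
(* The order is not 1 because v_i and w_i are distinct. *)
have m1 : (1 < m)%N.
  rewrite ltn_neqAle tors0 andbT; apply/eqP => m1.
  have [z Hz] := torsion_multiple (arc C i) (cycle_len C i).
  rewrite -/(torsion C i) -/m -m1 mul1r in Hz.
  have /andP[] := arc_itv C i; have l0 := cycle_len_gt0 C i.
  rewrite Hz pmulr_lgt0 // gtr_pMl // (ltr_int _ 0) (ltr_int _ _ 1); lia.
have mi : (1 < m <= i.+1)%N by rewrite m1.
have [y Hy] := fill_hook mi tors_multiple.
pose J := ~: [set k : 'I_n.+1 | (i.+1 - m <= k < i.+1)%N].
have cardJ : (#|J| + m = n.+1)%N.
  rewrite cardsCs finset.setCK card_ord card_ord_itv ?ltn_ord // subKn ?subnK //.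
  exact: leq_trans (ltn_ord i).
have cell : contains_cell (W (chain_mark C) (hook m)) #|J|.
  apply: (free_cell (y := y)) => x Hx r.
  apply: leq_trans (rows_le_mono _ _ _ _ (ltn_ord i)).
  apply: Hy => j ij ji; have jn : (j < n.+1)%N by apply: leq_ltn_trans ji (ltn_ord i).
  by have := Hx (inord j); rewrite !inE inordK // negbK leq_subLR addnC ij ltnS ji; exact.
have part_hook : is_partition (hook m).
  by rewrite /is_partition /hook /=; case: (m.-1) => //= k; elim: k.
have size_hook : size (boxes (hook m)) = m.+1.
  by rewrite size_boxes /= sumn_nseq mul1n; lia.
have [] := general (hook m) part_hook; rewrite size_hook genus_chain => dim_W W_empty.
have [le_g|/W_empty W0] := leqP m.+1 n.+1.
  by have [_ /(_ _ cell)] := dim_W le_g; lia.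
have [D [a [_ _ inW]]] := cell.
have := inW (fun j => (j == ord0)%:R); rewrite W0; apply.
  by move=> j; apply: ler0n.
by rewrite big_ord_recl eqxx big1 ?addr0 // => j _.
Qed.

End Main.

(* The cycle called i in {2, ..., g} is the cycle of index i - 1 > 0 here, and
   g = n.+1. *)
Theorem theorem1p3 (R : realType) (n : nat) (C : chain_of_cycles R n) :
  Brill_Noether_general (chain_mark C) <->
  (forall i : 'I_n.+1, (0 < i)%N -> torsion C i = 0%N \/ (i.+1 < torsion C i)%N).
Proof.
by split; [exact: general_large_torsion|exact: large_torsion_general].
Qed.
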